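(* Let $S=\mathbb{C}[x_0,\dots,x_n]$ and $\mathfrak{m}=(x_0,\dots,x_n)$. Let $p\ge 1$ be an integer and let $I\subseteq S$ be an $\mathfrak{m}$-primary ideal generated by homogeneous polynomials of degree $d$ such that the minimal free resolution of $I$ is virtually linear for $p$ steps. Then $$I^t=\mathfrak{m}^{td}\quad\text{for all integers } t\ge \left\lceil \frac{n}{p}\right\rceil .$$
   Context: $S=\mathbb{C}[x_0,\dots,x_n]$ carries the standard grading. An ideal $I$ generated by homogeneous polynomials $f_0,\dots,f_m$ all of degree $d$ is called $\mathfrak{m}$-primary if $I_t=\mathfrak{m}_t$ (degree $t$ graded pieces) for all sufficiently large $t$; equivalently, the common zero locus of $f_0,\dots,f_m$ in $\mathbb{C}^{n+1}$ is supported at the origin. The linear strand of the minimal graded free resolution of $I$ is the complex $$\cdots \to S(-d-p)^{\beta_{p,d}}\to S(-d-p+1)^{\beta_{p-1,d}}\to\cdots\to S(-d)^{\beta_{0,d}}\to I\to 0,$$ where $\beta_{i,d}=\dim_{\mathbb{C}}\operatorname{Tor}_i^S(I,\mathbb{C})_{i+d}$; that is, the subcomplex of the minimal free resolution whose $i$-th term consists of the summands $S(-d-i)$, augmented to $I$. The resolution of $I$ is virtually linear for $p$ steps if the complex of coherent sheaves on $\mathbb{P}^n$ obtained by sheafifying the linear strand is exact through the first $p-1$ steps, i.e. $\mathcal{O}_{\mathbb{P}^n}(-d)^{\beta_{0,d}}\to \widetilde{I}=\mathcal{O}_{\mathbb{P}^n}$ is surjective and the complex is exact at the term $\mathcal{O}_{\mathbb{P}^n}(-d-i)^{\beta_{i,d}}$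 for every $0\le i\le p-1$. *)

(* Defs.v *)
From mathcomp Require Import all_boot all_order all_algebra.
From mathcomp Require Import reals complex.
From mathcomp Require Import mpoly.

Set Implicit Arguments.
Unset Strict Implicit.
Unset Printing Implicit Defensive.

Import GRing.Theory Num.Theory.

Local Open Scope ring_scope.

(* Ideals of S = K[x_0, ..., x_n] are predicates S -> Prop. *)

Definition ideal_gen (K : fieldType) (n : nat)
    (A : {mpoly K[n.+1]} -> Prop) : {mpoly K[n.+1]} -> Prop :=
  fun g => exists (k : nat) (c a : 'I_k -> {mpoly K[n.+1]}),
    (forall i, A (a i)) /\ g = \sum_(i < k) c i * a i.

Definition ideal_mul (K : fieldType) (n : nat)
    (I J : {mpoly K[n.+1]} -> Prop) : {mpoly K[n.+1]} -> Prop :=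
  ideal_gen (fun g => exists a b, [/\ I a, J b & g = a * b]).

Fixpoint ideal_pow (K : fieldType) (n : nat)
    (I : {mpoly K[n.+1]} -> Prop) (t : nat) : {mpoly K[n.+1]} -> Prop :=
  if t is t'.+1 then ideal_mul I (ideal_pow I t') else fun _ => True.

Definition irrelevant_ideal (K : fieldType) (n : nat) :
    {mpoly K[n.+1]} -> Prop :=
  ideal_gen (fun g => exists i : 'I_n.+1, g = 'X_i).

Definition m_primary (K : fieldType) (n : nat)
    (I : {mpoly K[n.+1]} -> Prop) : Prop :=
  exists t0 : nat, forall t, (t0 <= t)%N ->
    forall g : {mpoly K[n.+1]}, g \is t.-homog ->
      (I g <-> irrelevant_ideal g).

(* Augmented complexes ... -> F_1 -> F_0 -> S of finitely generated graded
   free modules and degree 0 maps, with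
     F_i = \bigoplus_(k < gfc_rank i) S(- gfc_twist i k).
   Elements are row vectors and maps act by multiplication on the right.
   A degree 0 map S(-a) -> S(-b) is the multiplication by a form of degree
   a - b.  Twists are natural numbers: this is no restriction for the minimal
   resolution of an ideal of S. *)
Record graded_free_complex (K : fieldType) (n : nat) := GradedFreeComplex {
  gfc_rank : nat -> nat;
  gfc_twist : forall i : nat, 'I_(gfc_rank i) -> nat;
  gfc_diff : forall i : nat, 'M[{mpoly K[n.+1]}]_(gfc_rank i.+1, gfc_rank i);
  gfc_aug : 'cV[{mpoly K[n.+1]}]_(gfc_rank 0);
  gfc_diff_homog : forall i (j : 'I_(gfc_rank i.+1)) (k : 'I_(gfc_rank i)),
    if (gfc_twist k <= gfc_twist j)%N
    then gfc_diff i j k \is (gfc_twist j - gfc_twist k).-homog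
    else gfc_diff i j k == 0;
  gfc_aug_homog : forall j : 'I_(gfc_rank 0),
    gfc_aug j 0 \is (gfc_twist j).-homog }.

Definition is_free_resolution (K : fieldType) (n : nat)
    (F : graded_free_complex K n) (I : {mpoly K[n.+1]} -> Prop) : Prop :=
  [/\ (forall g, I g <-> exists v : 'rV_(gfc_rank F 0), v *m gfc_aug F = g%:M),
      (forall v : 'rV_(gfc_rank F 0), v *m gfc_aug F = 0 <->
         exists w : 'rV_(gfc_rank F 1), v = w *m gfc_diff F 0)
    & (forall i (v : 'rV_(gfc_rank F i.+1)), v *m gfc_diff F i = 0 <->
         exists w : 'rV_(gfc_rank F i.+2), v = w *m gfc_diff F i.+1)].

Definition is_minimal (K : fieldType) (n : nat)
    (F : graded_free_complex K n) : Prop :=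
  forall i (j : 'I_(gfc_rank F i.+1)) (k : 'I_(gfc_rank F i)),
    irrelevant_ideal (gfc_diff F i j k).

Definition is_minimal_free_resolution (K : fieldType) (n : nat)
    (F : graded_free_complex K n) (I : {mpoly K[n.+1]} -> Prop) : Prop :=
  is_free_resolution F I /\ is_minimal F.

(* Points of the scheme P^n = Proj S: the homogeneous prime ideals that do not
   contain all the variables. *)
Definition proj_point (K : fieldType) (n : nat)
    (P : {mpoly K[n.+1]} -> Prop) : Prop :=
  [/\ (forall g, ideal_gen P g -> P g),
      ~ P 1,
      (forall f g, P (f * g) -> P f \/ P g),
      (forall f e, P f -> P (pihomog mdeg e f))
    & exists i : 'I_n.+1, ~ P 'X_i].

(* The stalk at P of the sheaf on Proj S associated with the graded module
   J(-a), J a homogeneous ideal: the degree 0 part of the localization of J(-a)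
   at the forms not in P.  As S is a domain it is realized inside Frac S, as
   the set of f / g with f in J, g not in P, and deg g = deg f + a. *)
Definition stalk (K : fieldType) (n : nat) (P J : {mpoly K[n.+1]} -> Prop)
    (a : nat) (x : {fraction {mpoly K[n.+1]}}) : Prop :=
  exists (e : nat) (f g : {mpoly K[n.+1]}),
    [/\ J f, f \is e.-homog, g \is (e + a).-homog, ~ P g
      & x = tofrac f / tofrac g].

Definition structure_stalk (K : fieldType) (n : nat)
    (P : {mpoly K[n.+1]} -> Prop) (a : nat) :
    {fraction {mpoly K[n.+1]}} -> Prop :=
  stalk P (fun _ => True) a.

(* The i-th term of the linear strand is the sum of the summands S(-d-i) of
   F_i; this is the stalk at P of the associated sheaf, embedded in the stalk
   of the sheaf associated with F_i.  When F is a minimal resolution of an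
   ideal generated in degree d, these summands form a subcomplex of F, so the
   maps of the linear strand are the restrictions of those of F. *)
Definition strand_stalk (K : fieldType) (n : nat)
    (F : graded_free_complex K n) (d : nat) (P : {mpoly K[n.+1]} -> Prop)
    (i : nat) (v : 'rV[{fraction {mpoly K[n.+1]}}]_(gfc_rank F i)) : Prop :=
  forall k, if gfc_twist k == (d + i)%N then structure_stalk P (d + i) (v 0 k)
            else v 0 k = 0.

Definition frac_diff (K : fieldType) (n : nat) (F : graded_free_complex K n)
    (i : nat) : 'M[{fraction {mpoly K[n.+1]}}]_(gfc_rank F i.+1, gfc_rank F i) :=
  map_mx (@tofrac _) (gfc_diff F i).

Definition frac_aug (K : fieldType) (n : nat) (F : graded_free_complex K n) :
    'cV[{fraction {mpoly K[n.+1]}}]_(gfc_rank F 0) :=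
  map_mx (@tofrac _) (gfc_aug F).

Definition strand_onto_at (K : fieldType) (n : nat)
    (F : graded_free_complex K n) (I : {mpoly K[n.+1]} -> Prop) (d : nat)
    (P : {mpoly K[n.+1]} -> Prop) : Prop :=
  forall x, stalk P I 0 x ->
    exists2 v, strand_stalk d P v & v *m frac_aug F = x%:M.

Definition strand_kernel (K : fieldType) (n : nat)
    (F : graded_free_complex K n) (i : nat) :
    'rV[{fraction {mpoly K[n.+1]}}]_(gfc_rank F i) -> Prop :=
  if i is i'.+1 then fun v => v *m frac_diff F i' = 0
  else fun v => v *m frac_aug F = 0.

Definition strand_exact_at (K : fieldType) (n : nat)
    (F : graded_free_complex K n) (d : nat) (P : {mpoly K[n.+1]} -> Prop)
    (i : nat) : Prop :=
  forall v : 'rV_(gfc_rank F i), strand_stalk d P v ->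
    (strand_kernel v <->
     exists2 w : 'rV_(gfc_rank F i.+1),
       strand_stalk d P w & v = w *m frac_diff F i).

(* Exactness of a complex of sheaves is exactness on all stalks. *)
Definition virtually_linear (K : fieldType) (n : nat)
    (F : graded_free_complex K n) (I : {mpoly K[n.+1]} -> Prop) (d p : nat) :
    Prop :=
  forall P : {mpoly K[n.+1]} -> Prop, proj_point P ->
    strand_onto_at F I d P /\
    forall i, (i < p)%N -> strand_exact_at F d P i.

(* Main.v *)
(* Truncate the linear strand after p + 1 steps and augment it to a complex
   C : S <- L_0 <- ... <- L_p.  Virtual linearity makes its homology below the
   top degree p + 1 torsion with respect to the irrelevant ideal; equivalently,
   for each variable x, some power of x is homotopic to a map that vanishes
   below the top degree.  Such homotopies tensor, so the homology of
   T = C^(x)t is torsion below degree t (p + 1).  As t p >= n, going modulo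
   powers of the n + 1 variables one at a time moves homology of T in degree
   k < t and internal degree t d up to degree k + n + 1, where it vanishes
   because the generators of T have too small a twist.

   Now let k < t, let v be in I_d and lift it to u in L_0.  The differential of
   the (k+1)-fold tensor power of u is v z for a cycle z of degree k, and for a
   form g of degree (t - k) d the cycle g z bounds in T.  Pairing a bounding
   chain with the product of k augmentations of L_0 and the identities of S
   gives g v^k in I^(k+1).  By polarization the degree t d part of I^k lies in
   I^(k+1), hence every form of degree t d lies in I^t. *)

Require Import Defs.
From mathcomp Require Import all_boot all_order all_algebra.
From mathcomp Require Import reals complex.
From mathcomp Require Import mpoly.
From mathcomp Require Import mxtens zify ring.
From mathcomp Require classical_sets boolp.

Set Implicit Arguments.
Unset Strict Implicit.
Unset Printing Implicit Defensive.

Import GRing.Theory Num.Theory.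

Local Open Scope ring_scope.

(** * Contracting homotopies *)

(** An equation [D h + h D = s] below a degree passes to tensor products with additive bounds, which
    torsion of homology alone does not visibly do. The bound per factor is p + 1, the degree of L_p,
    where exactness is not assumed; over t factors it becomes t (p + 1). The worst case k = t - 1
    then asks for t + n <= t (p + 1), which is t p >= n.

    For d > 0 a generator of C in degree h has twist at most d + h - 1, so one of T in degree k + n
    + 1 has twist at most t d + n. Moving there raises the internal degree by the sum of the
    exponents of the powers used, so coefficients have degree above the sum of (exponent - 1), and
    each of their monomials is divisible by one of the powers. The size of the exponents is
    therefore irrelevant.

    A complex is one square matrix with degree functions [hd] and [tw] on its indices, so that
    tensor powers have the same form. Homology is never formed: statements are about cycles and
    boundaries, and congruences modulo powers of variables are read off supports. *)

Section TensorAlgebra.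
Variable S : comNzRingType.

Lemma tensmxDl m n p q (A B : 'M[S]_(m, n)) (C : 'M_(p, q)) :
  (A + B) *t C = A *t C + B *t C.
Proof. by apply/matrixP => i j; rewrite !mxE mulrDl. Qed.

Lemma tensmxDr m n p q (A : 'M[S]_(m, n)) (B C : 'M_(p, q)) :
  A *t (B + C) = A *t B + A *t C.
Proof. by apply/matrixP => i j; rewrite !mxE mulrDr. Qed.

Lemma tensmxZl m n p q a (A : 'M[S]_(m, n)) (C : 'M_(p, q)) :
  (a *: A) *t C = a *: (A *t C).
Proof. by apply/matrixP => i j; rewrite !mxE mulrA. Qed.

Lemma tensmxZr m n p q a (A : 'M[S]_(m, n)) (C : 'M_(p, q)) :
  A *t (a *: C) = a *: (A *t C).
Proof. by apply/matrixP => i j; rewrite !mxE mulrCA. Qed.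

Lemma tensmxNl m n p q (A : 'M[S]_(m, n)) (C : 'M_(p, q)) :
  (- A) *t C = - (A *t C).
Proof. by rewrite -scaleN1r tensmxZl scaleN1r. Qed.

Lemma tensmxNr m n p q (A : 'M[S]_(m, n)) (C : 'M_(p, q)) :
  A *t (- C) = - (A *t C).
Proof. by rewrite -scaleN1r tensmxZr scaleN1r. Qed.

Lemma tens_scalar m n (a b : S) :
  a%:M *t b%:M = (a * b)%:M :> 'M[S]_(m * n).
Proof.
apply/matrixP => i j.
case: (mxtens_indexP i) => i1 i2; case: (mxtens_indexP j) => j1 j2.
rewrite tensmxE !mxE (can_eq (@mxtens_indexK m n)) xpair_eqE.
by case: (i1 == j1); case: (i2 == j2); rewrite ?mulr0n ?mulr1n ?mul0r ?mulr0.
Qed.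

(** Two offsets replace one integer shift: [0 1] means degree -1 and [1 0] means degree 1. Vectors
    are rows, so [D *m h] applies [D] first. *)
Definition mxdeg m n (f : 'I_m -> nat) (g : 'I_n -> nat) (a b : nat)
    (A : 'M[S]_(m, n)) : Prop :=
  forall i j, A i j != 0 -> (f i + a = g j + b)%N.

Lemma mxdegM m n q (f : 'I_m -> nat) (g : 'I_n -> nat) (h : 'I_q -> nat)
    a b a' b' (A : 'M_(m, n)) (B : 'M_(n, q)) :
  mxdeg f g a b A -> mxdeg g h a' b' B ->
  mxdeg f h (a + a') (b + b') (A *m B).
Proof.
move=> dA dB i j; rewrite mxE => nz; apply/eqP; apply: contraNT nz => neq.
rewrite big1 // => k _.
have [->|/dA e1] := eqVneq (A i k) 0; first by rewrite mul0r.
have [->|/dB e2] := eqVneq (B k j) 0; first by rewrite mulr0.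
case/eqP: neq; lia.
Qed.

Lemma mxdegD m n (f : 'I_m -> nat) (g : 'I_n -> nat) a b (A B : 'M_(m, n)) :
  mxdeg f g a b A -> mxdeg f g a b B -> mxdeg f g a b (A + B).
Proof.
move=> dA dB i j; rewrite mxE.
have [->|/dA //] := eqVneq (A i j) 0; rewrite add0r; exact: dB.
Qed.

Lemma mxdegZ m n (f : 'I_m -> nat) (g : 'I_n -> nat) a b c (A : 'M_(m, n)) :
  mxdeg f g a b A -> mxdeg f g a b (c *: A).
Proof.
move=> dA i j; rewrite mxE => nz; apply: dA.
by apply: contraNneq nz => ->; rewrite mulr0.
Qed.

Lemma mxdegN m n (f : 'I_m -> nat) (g : 'I_n -> nat) a b (A : 'M_(m, n)) :
  mxdeg f g a b A -> mxdeg f g a b (- A).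
Proof. by rewrite -scaleN1r; apply: mxdegZ. Qed.

Lemma mxdeg_scalar m (f : 'I_m -> nat) a c : mxdeg f f a a c%:M.
Proof.
by move=> i j; rewrite mxE; have [->|_] := eqVneq i j; rewrite ?mulr0n ?eqxx.
Qed.

Lemma mxdeg_sub m n (f : 'I_m -> nat) (g : 'I_n -> nat) a b c (A : 'M_(m, n)) :
  mxdeg f g (a + c) (b + c) A -> mxdeg f g a b A.
Proof. by move=> dA i j /dA; lia. Qed.

Definition tens_grading r r' (hd : 'I_r -> nat) (hd' : 'I_r' -> nat)
    (k : 'I_(r * r')) : nat :=
  (hd (mxtens_unindex k).1 + hd' (mxtens_unindex k).2)%N.

Lemma mxdegT m n p q (f : 'I_m -> nat) (g : 'I_n -> nat) (f' : 'I_p -> nat)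
    (g' : 'I_q -> nat) a b a' b' (A : 'M_(m, n)) (B : 'M_(p, q)) :
  mxdeg f g a b A -> mxdeg f' g' a' b' B ->
  mxdeg (tens_grading f f') (tens_grading g g') (a + a') (b + b') (A *t B).
Proof.
move=> dA dB i j; rewrite mxE => nz; rewrite /tens_grading.
set i1 := mxtens_unindex i in nz *; set j1 := mxtens_unindex j in nz *.
have eA : A i1.1 j1.1 != 0 by apply: contraNneq nz => ->; rewrite mul0r.
have eB : B i1.2 j1.2 != 0 by apply: contraNneq nz => ->; rewrite mulr0.
have := dA _ _ eA; have := dB _ _ eB; lia.
Qed.

Definition parity_mx r (hd : 'I_r -> nat) : 'M[S]_r :=
  diag_mx (\row_b (-1) ^+ hd b).

Lemma parity_mxK r (hd : 'I_r -> nat) : parity_mx hd *m parity_mx hd = 1%:M.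
Proof.
rewrite mulmx_diag; apply/matrixP => i j; rewrite !mxE.
by rewrite -expr2 -exprM mulnC exprM sqrrN expr1n expr1n.
Qed.

Lemma parity_mx_deg r (hd : 'I_r -> nat) : mxdeg hd hd 0 0 (parity_mx hd).
Proof.
by move=> i j; rewrite !mxE; have [->|_] := eqVneq i j; rewrite ?mulr0n ?eqxx.
Qed.

Lemma mul_parity_mx m n (f : 'I_m -> nat) (g : 'I_n -> nat) a b (A : 'M_(m, n)) :
  mxdeg f g a b A ->
  parity_mx f *m A = (-1) ^+ (a + b) *: (A *m parity_mx g).
Proof.
move=> dA; apply/matrixP => i j; rewrite mul_diag_mx mxE [in RHS]mxE.
rewrite mul_mx_diag !mxE.
have [->|/dA e] := eqVneq (A i j) 0; first by rewrite !(mulr0, mul0r).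
rewrite mulrCA [LHS]mulrC; congr (_ * _).
rewrite -exprD -signr_odd -[RHS]signr_odd; congr (_ ^+ _).
congr nat_of_bool; move: e => /(congr1 odd); rewrite !oddD.
by do 4!case: odd.
Qed.

(** The differential of a tensor product of complexes; [parity_mx] carries the Koszul sign. *)
Definition tens_diff r r' (hd : 'I_r -> nat) (D : 'M[S]_r) (D' : 'M[S]_r') :
    'M[S]_(r * r') :=
  D *t 1%:M + parity_mx hd *t D'.

Lemma tens_diff_deg r r' (hd : 'I_r -> nat) (hd' : 'I_r' -> nat) D D' :
  mxdeg hd hd 0 1 D -> mxdeg hd' hd' 0 1 D' ->
  mxdeg (tens_grading hd hd') (tens_grading hd hd') 0 1 (tens_diff hd D D').
Proof.
move=> dD dD'; apply: mxdegD.
  by rewrite -[0%N]addn0 -[1%N]addn0; apply/mxdegT/mxdeg_scalar.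
rewrite -[0%N]addn0 -[1%N]add0n; apply: mxdegT => //; exact: parity_mx_deg.
Qed.

Lemma tens_diff_sq r r' (hd : 'I_r -> nat) (D : 'M_r) (D' : 'M_r') :
  mxdeg hd hd 0 1 D -> D *m D = 0 -> D' *m D' = 0 ->
  tens_diff hd D D' *m tens_diff hd D D' = 0.
Proof.
move=> dD D2 D'2; rewrite mulmxDl !mulmxDr !tensmx_mul D2 D'2.
rewrite (mul_parity_mx dD) !(mulmx1, mul1mx) !(tens0mx, tensmx0) add0r addr0.
by rewrite expr1 scaleN1r tensmxNl subrr.
Qed.

(** Only the homological degree of [h] is prescribed; internal degrees are restored later by
    [bipart]. *)
Definition contractible_below r (hd : 'I_r -> nat) (D : 'M[S]_r) (M : nat)
    (s : S) : Prop :=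
  exists2 h, mxdeg hd hd 1 0 h &
    forall b, (hd b < M)%N -> row b (D *m h + h *m D) = row b s%:M.

(* [pi = s - (D h + h D)] is a chain map vanishing below [M]; the homotopy
   below joins [s s'] to [pi (x) pi'], which vanishes below [M + M']. *)
Lemma contractible_tens r r' (hd : 'I_r -> nat) (hd' : 'I_r' -> nat)
    (D : 'M_r) (D' : 'M_r') M M' s s' :
  mxdeg hd hd 0 1 D -> D *m D = 0 ->
  contractible_below hd D M s -> contractible_below hd' D' M' s' ->
  contractible_below (tens_grading hd hd') (tens_diff hd D D') (M + M') (s * s').
Proof.
move=> dD D2 [h dh hP] [h' dh' hP'].
have [pi piE] : exists x : 'M[S]_r, x = s%:M - (D *m h + h *m D) by eexists.
have [pi' pi'E] : exists x : 'M[S]_r', x = s'%:M - (D' *m h' + h' *m D') by eexists.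
have [e eE] : exists x : 'M[S]_r, x = parity_mx hd by eexists.
have dpi : mxdeg hd hd 0 0 pi.
  rewrite piE.
  apply: mxdegD; first exact: mxdeg_scalar.
  apply/mxdegN; apply: (@mxdeg_sub _ _ _ _ _ _ 1); apply: mxdegD.
    exact: (mxdegM dD dh).
  exact: (mxdegM dh dD).
have eD : e *m D = - (D *m e) by rewrite eE (mul_parity_mx dD) expr1 scaleN1r.
have eh : e *m h = - (h *m e) by rewrite eE (mul_parity_mx dh) expr1 scaleN1r.
have epi : e *m pi = pi *m e by rewrite eE (mul_parity_mx dpi) expr0 scale1r.
have piD : pi *m D = D *m pi.
  rewrite piE mulmxBl mulmxBr mulmxDl mulmxDr -[h *m D *m D]mulmxA.
  rewrite [D *m (D *m h)]mulmxA D2 mulmx0 mul0mx addr0 add0r.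
  by rewrite mulmxA scalar_mxC.
have e2 : e *m e = 1%:M by rewrite eE; exact: parity_mxK.
(* [D H + H D] becomes (s - pi) (x) s' + pi (x) (s' - pi') = s s' - pi (x) pi'. The cross terms
   cancel because [e] anticommutes with [D] and [h]. *)
pose H := h *t s'%:M + (e *m pi) *t h'.
have key : tens_diff hd D D' *m H + H *m tens_diff hd D D' =
    (s * s')%:M - pi *t pi'.
  rewrite /tens_diff /H -eE !(mulmxDl, mulmxDr) !tensmx_mul.
  rewrite !(mulmx1, mul1mx).
  have -> : D *m (e *m pi) = - (e *m pi *m D).
    by rewrite -mulmxA piD !mulmxA eD mulNmx opprK.
  have -> : e *m (e *m pi) = pi by rewrite mulmxA e2 mul1mx.
  have -> : e *m pi *m e = pi by rewrite epi -mulmxA e2 mulmx1.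
  rewrite eh [D' *m s'%:M]scalar_mxC.
  rewrite !tensmxNl.
  have -> : pi *t pi' = pi *t s'%:M - (pi *t (D' *m h') + pi *t (h' *m D')).
    rewrite pi'E.
    by rewrite -tensmxDr -tensmxNr -tensmxDr.
  have -> : (s * s')%:M = pi *t s'%:M + (D *m h *t s'%:M + h *m D *t s'%:M)
      :> 'M[S]_(r * r').
    by rewrite -!tensmxDl piE subrK tens_scalar.
  (* With the tensor products abstracted, a linear identity between matrices remains. *)
  move: (_ *t _) (_ *t _) (_ *t _) (_ *t _) (_ *t _) (_ *t _) (_ *t _).
  move=> *; apply/matrixP => i j; rewrite !mxE; ring.
exists H.
  apply: mxdegD.
    by rewrite -[1%N]addn0 -[0%N]addn0; apply/mxdegT/mxdeg_scalar.
  rewrite -[1%N]add0n -[0%N]addn0; apply: mxdegT => //.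
  by rewrite -[0%N]addn0 eE; apply: mxdegM dpi; apply: parity_mx_deg.
move=> b lt_b; rewrite key; apply/rowP => c; rewrite !mxE.
set b1 := mxtens_unindex b; set c1 := mxtens_unindex c.
suff -> : pi b1.1 c1.1 * pi' b1.2 c1.2 = 0 by rewrite subr0.
have [lt1|ge1] := ltnP (hd b1.1) M.
  have /rowP/(_ c1.1) := hP _ lt1; rewrite piE !mxE => ->.
  by rewrite subrr mul0r.
have lt2 : (hd' b1.2 < M')%N by move: lt_b; rewrite /tens_grading -/b1; lia.
have /rowP/(_ c1.2) := hP' _ lt2; rewrite pi'E !mxE => ->.
by rewrite subrr mulr0.
Qed.
End TensorAlgebra.

(** * Vanishing of homology *)

Section MonomialSelection.
Variables (N : nat) (K : comNzRingType).
Implicit Types (p q f : {mpoly K[N]}) (m : 'X_{1..N}).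

Definition mpoly_sel (Q : pred 'X_{1..N}) p : {mpoly K[N]} :=
  \sum_(m <- msupp p | Q m) p@_m *: 'X_[m].

Lemma mcoeff_sel Q p m : (mpoly_sel Q p)@_m = if Q m then p@_m else 0.
Proof.
rewrite /mpoly_sel raddf_sum /= big_mkcond /=.
have [m_p|m_p] := boolP (m \in msupp p).
  rewrite (bigD1_seq m) ?msupp_uniq //= big1_seq ?addr0.
    by case: (Q m) => //; rewrite mcoeffZ mcoeffX eqxx mulr1.
  move=> m' /andP[ne _]; case: (Q m') => //.
  by rewrite mcoeffZ mcoeffX (negbTE ne) mulr0.
rewrite (memN_msupp_eq0 m_p) if_same big1_seq // => m' /andP[_ m'_p].
case: (Q m') => //; rewrite mcoeffZ mcoeffX.
by case: eqP m'_p m_p => [-> ->//|_ _ _]; rewrite mulr0.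
Qed.

Lemma msupp_sel Q p m : (m \in msupp (mpoly_sel Q p)) = Q m && (m \in msupp p).
Proof. by rewrite !mcoeff_msupp mcoeff_sel; case: (Q m); rewrite ?eqxx. Qed.

Lemma mpoly_selD Q p : p = mpoly_sel Q p + mpoly_sel (predC Q) p.
Proof.
apply/mpolyP => m; rewrite mcoeffD !mcoeff_sel /=.
by case: (Q m); rewrite ?addr0 ?add0r.
Qed.

Lemma pihomog_sel d p : pihomog mdeg d p = mpoly_sel (fun m => mdeg m == d) p.
Proof. by []. Qed.

Lemma mpoly_dvd_Xn (i : 'I_N) k p :
  (forall m, m \in msupp p -> (k <= m i)%N) -> exists r, p = 'X_i ^+ k * r.
Proof.
move=> le_k; exists (\sum_(m <- msupp p) p@_m *: 'X_[m - U_(i) *+ k]).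
rewrite {1}[p]mpolyE mulr_sumr; apply: eq_big_seq => m /le_k le_m.
rewrite mpolyXn -scalerAr -mpolyXD addmC submK //.
apply/mnm_lepP => j; rewrite mulmnE mnm1E.
by have [<-|_] := eqVneq i j; rewrite ?mul1n ?mul0n.
Qed.

Lemma mem_msuppXnM (i : 'I_N) k p m :
  m \in msupp p -> (m + U_(i) *+ k)%MM \in msupp ('X_i ^+ k * p).
Proof.
move=> m_p; rewrite mpolyXn -commr_mpolyX mcoeff_msupp addmC mcoeffMX.
by rewrite -mcoeff_msupp.
Qed.

Lemma mem_msuppM p q m : m \in msupp (p * q) ->
  exists m1 m2, [/\ m1 \in msupp p, m2 \in msupp q & m = (m1 + m2)%MM].
Proof. by move/msuppM_le/allpairsP => [[m1 m2] /= [? ? ->]]; exists m1, m2. Qed.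

(** Membership in the ideal generated by the X_l^(k l) with l < i, read off the support; this avoids
    quotient rings. *)
Definition monideal (k : 'I_N -> nat) (i : nat) f : Prop :=
  forall m, m \in msupp f -> exists2 l : 'I_N, (l < i)%N & (k l <= m l)%N.

Lemma monideal0 k i : monideal k i 0.
Proof. by move=> m; rewrite msupp0. Qed.

Lemma monidealD k i p q :
  monideal k i p -> monideal k i q -> monideal k i (p + q).
Proof. by move=> Jp Jq m /msuppD_le; rewrite mem_cat => /orP[/Jp|/Jq]. Qed.

Lemma monidealMr k i p q : monideal k i p -> monideal k i (p * q).
Proof.
move=> Jp m /mem_msuppM[m1 [m2 [/Jp[l lt_l le_k] _ ->]]].
by exists l; rewrite // mnmDE; lia.
Qed.

Lemma monideal_sum k i (I : Type) (r : seq I) (F : I -> {mpoly K[N]}) :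
  (forall j, monideal k i (F j)) -> monideal k i (\sum_(j <- r) F j).
Proof.
by move=> JF; elim/big_ind: _ => //; [exact: monideal0 | exact: monidealD].
Qed.

Lemma monidealN k i p : monideal k i p -> monideal k i (- p).
Proof. by move=> Jp; rewrite -mulrN1; apply: monidealMr. Qed.

Lemma monideal_sel k i Q p : monideal k i p -> monideal k i (mpoly_sel Q p).
Proof. by move=> Jp m; rewrite msupp_sel => /andP[_ /Jp]. Qed.

Lemma monidealS k (i : 'I_N) p : monideal k i p -> monideal k i.+1 p.
Proof. by move=> Jp m /Jp[l lt_l le_k]; exists l => //; apply: ltnW. Qed.

Lemma monideal_Xn k (i : 'I_N) p : monideal k i.+1 ('X_i ^+ k i * p).
Proof.
move=> m /mem_msuppM[m1 [m2 []]].
rewrite mpolyXn msuppX inE => /eqP -> _ ->; exists i => //.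
by rewrite mnmDE mulmnE mnm1E eqxx mul1n leq_addr.
Qed.

(** Monomials divisible by X_i^(k i) go to the first summand; the others owe their membership to an
    earlier variable. *)
Lemma monideal_decomp k (i : 'I_N) p :
  monideal k i.+1 p -> exists r q, p = 'X_i ^+ k i * r + q /\ monideal k i q.
Proof.
move=> Jp; pose Q m := (k i <= m i)%N.
have [m|r rE] := @mpoly_dvd_Xn i (k i) (mpoly_sel Q p).
  by rewrite msupp_sel => /andP[].
exists r, (mpoly_sel (predC Q) p); split; first by rewrite -rE -mpoly_selD.
move=> m; rewrite msupp_sel => /andP[/= ltk /Jp[l le_l le_k]]; exists l => //.
rewrite ltn_neqAle -ltnS le_l andbT; apply: contraNneq ltk => e.
by rewrite /Q -(val_inj e).
Qed.

(** X_i^(k i) is a nonzerodivisor modulo powers of the earlier variables: multiplication by it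
    shifts the support and leaves the exponents of those variables unchanged. *)
Lemma monideal_regular k (i : 'I_N) p :
  monideal k i ('X_i ^+ k i * p) -> monideal k i p.
Proof.
move=> JXp m m_p; have [l lt_l] := JXp _ (mem_msuppXnM i (k i) m_p).
rewrite mnmDE mulmnE mnm1E => le_k; exists l => //.
by move: le_k; have [e|_] := eqVneq i l; [move: lt_l; rewrite e ltnn | lia].
Qed.

Lemma pihomogM d e p q : q \is e.-homog ->
  pihomog mdeg (d + e) (p * q) = pihomog mdeg d p * q.
Proof.
(* The bound [d.+1] makes [d] an index of the partition even when [p] has smaller degree. *)
move=> q_hom; pose k := (maxn (msize p) d.+1).
have le_k : (msize p <= k)%N by rewrite leq_maxl.
rewrite {1}(pihomog_partitionE le_k) mulr_suml raddf_sum /=.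
have lt_dk : (d < k)%N by rewrite leq_maxr.
rewrite (bigD1 (Ordinal lt_dk)) //= big1 ?addr0.
  by rewrite pihomog_dE //; apply: dhomogM; rewrite ?pihomogP.
move=> j ne. apply: (@pihomog_ne0 _ _ _ (j + e)%N).
  by rewrite eqn_add2r; apply: contraNneq ne => e'; apply/eqP/val_inj.
by apply: dhomogM; rewrite ?pihomogP.
Qed.

Lemma pihomogM_lt d e p q : (d < e)%N -> q \is e.-homog ->
  pihomog mdeg d (p * q) = 0.
Proof.
move=> lt_d /dhomogP hq; apply/mpolyP => m.
rewrite pihomog_sel mcoeff_sel mcoeff0; case: eqP => // dm; apply/eqP.
rewrite mcoeff_eq0; apply/negP => /mem_msuppM[m1 [m2 [_ /hq d2 em]]].
by move: dm; rewrite em mdegD d2; lia.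
Qed.

End MonomialSelection.

(** * Cycles of a bigraded complex modulo powers of the variables *)

Section Vanishing.
Variables (N : nat) (K : comNzRingType).
Let S := {mpoly K[N]}.

Definition mx_monideal k i m n (A : 'M[S]_(m, n)) : Prop :=
  forall a b, monideal k i (A a b).

Lemma mx_monidealD k i m n (A B : 'M[S]_(m, n)) :
  mx_monideal k i A -> mx_monideal k i B -> mx_monideal k i (A + B).
Proof. by move=> JA JB a b; rewrite mxE; apply: monidealD. Qed.

Lemma mx_monidealN k i m n (A : 'M[S]_(m, n)) :
  mx_monideal k i A -> mx_monideal k i (- A).
Proof. by move=> JA a b; rewrite mxE; apply: monidealN. Qed.

Lemma mx_monidealM k i m n q (A : 'M[S]_(m, n)) (B : 'M[S]_(n, q)) :
  mx_monideal k i A -> mx_monideal k i (A *m B).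
Proof.
by move=> JA a b; rewrite mxE; apply: monideal_sum => c; apply: monidealMr.
Qed.

(** [f] and [g] are the twists of source and target, so entries are forms of degree [f a - g b]. A
    constant [f] expresses that a row vector is homogeneous of that degree. *)
Definition mx_homog m n (f : 'I_m -> nat) (g : 'I_n -> nat) (A : 'M[S]_(m, n)) :
    Prop :=
  forall a b mo, mo \in msupp (A a b) -> (mdeg mo + g b = f a)%N.

Variables (r : nat) (hd tw : 'I_r -> nat) (D : 'M[S]_r).
Hypotheses (dD : mxdeg hd hd 0 1 D) (D2 : D *m D = 0) (hD : mx_homog tw tw D).

(** The component of bidegree (j, e). Without the test [tw b <= e], truncated subtraction would
    select a constant term. *)
Definition bipart (j e : nat) (v : 'rV[S]_r) : 'rV[S]_r :=
  \row_b if (hd b == j) && (tw b <= e)%N then pihomog mdeg (e - tw b) (v 0 b)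
         else 0.

Lemma bipart_id j e v : mxdeg (fun=> j) hd 0 0 v ->
  mx_homog (fun=> e) tw v -> bipart j e v = v.
Proof.
move=> dv hv; apply/rowP => b; rewrite mxE.
have [->|nz] := eqVneq (v 0 b) 0; first by rewrite raddf0 if_same.
have := dv _ _ nz; rewrite !addn0 => ->; rewrite eqxx /=.
have e_b : (mdeg (mlead (v 0%R b)) + tw b = e)%N by apply/(hv 0)/mlead_supp.
rewrite -e_b leq_addl addnK; apply: pihomog_dE; apply/dhomogP => m /hv.
by rewrite -e_b => /addIn.
Qed.

Lemma bipart_deg j e v : mxdeg (fun=> j) hd 0 0 (bipart j e v).
Proof.
move=> a b; rewrite mxE; case: ifP => [/andP[/eqP-> _]//|_]; by rewrite eqxx.
Qed.

Lemma bipart_homog j e v : mx_homog (fun=> e) tw (bipart j e v).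
Proof.
move=> a b m; rewrite mxE; case: ifP => [/andP[_ le_e]|_]; last by rewrite msupp0.
rewrite pihomog_sel msupp_sel => /andP[/eqP -> _]; lia.
Qed.

Lemma bipart_diff j e v : bipart j e (v *m D) = bipart j.+1 e v *m D.
Proof.
apply/rowP => b; rewrite !mxE.
have [/andP[/eqP hb le_b]|no] := ifPn; last first.
  rewrite big1 // => c _; rewrite mxE.
  have [->|nz] := eqVneq (D c b) 0; first by rewrite mulr0.
  have [/andP[/eqP hc le_c]|_] := ifPn; last by rewrite mul0r.
  have := dD nz; have := hD (mlead_supp nz).
  by move=> e1 e2; exfalso; case/nandP: no => [/eqP|]; lia.
rewrite raddf_sum /=; apply: eq_bigr => c _; rewrite mxE.
have [->|nz] := eqVneq (D c b) 0; first by rewrite !mulr0 raddf0.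
have hc := dD nz; have tc := hD (mlead_supp nz).
have -> : (hd c == j.+1) by lia.
set d := mdeg _ in tc.
have Dd : D c b \is d.-homog.
  by apply/dhomogP => m /hD e1; apply/(@addIn (tw b)); rewrite e1 tc.
rewrite andTb; case: leqP => [le_c|gt_c].
  rewrite -(pihomogM _ _ Dd); congr pihomog; lia.
rewrite mul0r.
by apply: pihomogM_lt Dd; lia.
Qed.

Lemma bipart_monideal k i j e v :
  mx_monideal k i v -> mx_monideal k i (bipart j e v).
Proof.
move=> Jv a b; rewrite mxE; case: ifP => _; last exact: monideal0.
exact: monideal_sel.
Qed.

Lemma bipartD j e v w : bipart j e (v + w) = bipart j e v + bipart j e w.
Proof. by apply/rowP => b; rewrite !mxE raddfD; case: ifP; rewrite ?addr0. Qed.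

(* Descending induction on [i]: modulo the powers of the first [i] variables,
   homology in degree [j] embeds into homology in degree [j + 1] modulo one
   more power; after all variables only a degree count is left. *)
Lemma homology_vanishing M e j :
  (forall l : 'I_N, exists k, contractible_below hd D M ('X_l ^+ k)) ->
  (j + N <= M)%N ->
  (forall b, hd b = (j + N)%N -> (tw b < e + N)%N) ->
  forall v : 'rV_r, mxdeg (fun=> j) hd 0 0 v -> mx_homog (fun=> e) tw v ->
    v *m D = 0 -> exists w, v = w *m D.
Proof.
move=> /fin_all_exists[k /fin_all_exists2[H dH HP]] le_M lt_tw.
(* The internal degree reached with the first [i] variables: multiplication by X_l^(k l) adds
   [k l]. *)
pose E i := (e + \sum_(l < N | l < i) k l)%N.
suff main i : (i <= N)%N -> forall v : 'rV_r,
    mxdeg (fun=> j + (N - i))%N hd 0 0 v -> mx_homog (fun=> E (N - i)%N) tw v ->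
    mx_monideal k (N - i) (v *m D) ->
    exists w q, v = w *m D + q /\ mx_monideal k (N - i) q.
  move=> v dv hv vD; have [|||w [q [vE q0]]] := main N (leqnn N) v.
  - by rewrite subnn addn0.
  - by rewrite subnn /E big_pred0 ?addn0.
  - by rewrite vD => a b; rewrite mxE; apply: monideal0.
  exists w; suff -> : v = w *m D + 0 by rewrite addr0.
  rewrite {1}vE; congr (_ + _); apply/matrixP => a b; rewrite mxE; apply/eqP.
  rewrite -msupp_eq0; case sq: msupp => [//|m s].
  by have [] := q0 a b m; rewrite ?sq ?mem_head // subnn.
elim: i => [|i IH] lt_i v dv hv Jv.
  exists 0, v; split; first by rewrite mul0mx add0r.
  move=> a b m m_v; rewrite [a]ord1 in m_v.
  have nz : v 0 b != 0.
    by apply: contraTneq m_v => ->; rewrite msupp0.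
  have := hv _ _ _ m_v; have := lt_tw b; have := dv _ _ nz.
  rewrite !addn0 subn0 => -> /(_ erefl) lt_b em.
  have [/existsP[l le_k]|/existsPn none] := boolP [exists l, k l <= m l]%N.
    by exists l.
  (* If every exponent of [m] were below its [k l], the degree of [m] would be at most s - N; but it
     is e + s - tw b, and tw b < e + N. *)
  pose s := (\sum_(l < N) k l)%N.
  have EN : E N = (e + s)%N.
    by congr addn; apply: eq_bigl => l; rewrite ltn_ord.
  have le_s : (mdeg m + N <= s)%N.
    rewrite -{2}[N]card_ord -sum1_card mdegE -big_split /=.
    by apply: leq_sum => l _; rewrite addn1 ltnNge none.
  by rewrite EN in em; exfalso; lia.
have i'lt : (N - i.+1 < N)%N by lia.
pose l := Ordinal i'lt.
have eqi : (N - i = l.+1)%N by rewrite /=; lia.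
have hv' : mx_homog (fun=> E l) tw v by exact: hv.
have El : E l.+1 = (E l + k l)%N.
  rewrite /E (bigD1 l) ?ltnSn //= [(k l + _)%N]addnC addnA.
  congr (_ + _ + _)%N; apply: eq_bigl => c.
  by rewrite ltnS [(c < _)%N]ltn_neqAle andbC.
have HPv : 'X_l ^+ k l *: v = (v *m D) *m H l + (v *m H l) *m D.
  rewrite -[(v *m H l) *m D]mulmxA -mulmxA -mulmxDr.
  rewrite -mul_mx_scalar; apply/rowP => c; rewrite !mxE; apply: eq_bigr => b _.
  have [->|nz] := eqVneq (v 0 b) 0; first by rewrite !mul0r.
  have lt_b : (hd b < M)%N by have := dv _ _ nz; lia.
  by have /rowP/(_ c) := HP l _ lt_b; rewrite mxE [in RHS]mxE => ->.
(* [H l] need not preserve internal degrees, hence the projection. Since [v D] lies in the ideal of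
   the first l powers, [u] is a cycle modulo one more power. *)
pose u := bipart (j + l.+1) (E l.+1) (v *m H l).
have uD : u *m D = 'X_l ^+ k l *: v - bipart (j + l) (E l.+1) (v *m D *m H l).
  rewrite /u addnS -bipart_diff.
  have -> : 'X_l ^+ k l *: v = bipart (j + l) (E l.+1) ('X_l ^+ k l *: v).
    rewrite bipart_id //; first exact: mxdegZ.
    move=> a b m; rewrite mxE => /mem_msuppM[m1 [m2 []]].
    rewrite mpolyXn msuppX inE => /eqP-> /hv' e1 ->.
    by rewrite mdegD mdegMn mdeg1 El; lia.
  by rewrite HPv bipartD [RHS]addrAC subrr add0r.
have Ju : mx_monideal k l.+1 (u *m D).
  rewrite uD; apply: mx_monidealD.
    by move=> a b; rewrite mxE; apply: monideal_Xn.
  move=> a b; apply: monidealS; move: a b; apply: mx_monidealN.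
  by apply: bipart_monideal; apply: mx_monidealM.
have := IH (ltnW lt_i) u; rewrite eqi => /(_ _ _ Ju)[].
- exact: bipart_deg.
- exact: bipart_homog.
move=> w [q [uE Jq]].
have [r' /fin_all_exists[q' qE]] := fin_all_exists (fun b => monideal_decomp (Jq 0 b)).
pose rv : 'rV_r := \row_b r' b; pose qv : 'rV_r := \row_b q' b.
have qE' : q = 'X_l ^+ k l *: rv + qv.
  by apply/rowP => b; rewrite !mxE; case: (qE b).
(* Applying [D] to u = w D + X^k rv + qv kills the first term and puts X^k (v - rv D) into the
   smaller ideal, where X^k cancels by regularity. *)
exists rv, (v - rv *m D); split; first by rewrite addrC subrK.
move=> a b; apply: (@monideal_regular _ _ _ l); rewrite [a]ord1.
suff -> : 'X_l ^+ k l * (v - rv *m D) 0 b =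
    (qv *m D + bipart (j + l) (E l.+1) (v *m D *m H l)) 0 b.
  move: (0 : 'I_1) b; apply: mx_monidealD.
    apply: mx_monidealM => a' b'; rewrite mxE; exact: (qE b').2.
  by apply: bipart_monideal; apply: mx_monidealM.
suff -> : qv *m D + bipart (j + l) (E l.+1) (v *m D *m H l) =
    'X_l ^+ k l *: (v - rv *m D) by rewrite [RHS]mxE.
have -> : bipart (j + l) (E l.+1) (v *m D *m H l) = 'X_l ^+ k l *: v - u *m D.
  by rewrite uD opprB addrC subrK.
rewrite uE qE' !mulmxDl -mulmxA D2 mulmx0 add0r -scalemxAl scalerBr.
by rewrite opprD [qv *m D + _]addrC !addrA subrK.
Qed.
End Vanishing.

(** * From torsion homology to contracting homotopies *)

Section Contraction.
Variables (S : comNzRingType) (r : nat) (hd : 'I_r -> nat) (D : 'M[S]_r).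
Hypotheses (dD : mxdeg hd hd 0 1 D) (D2 : D *m D = 0).

Lemma mulmx_eq_rows (h h' : 'M[S]_r) m (A : 'M_(m, r)) (P : pred 'I_r) :
  (forall a b, A a b != 0 -> P b) -> (forall b, P b -> row b h = row b h') ->
  A *m h = A *m h'.
Proof.
move=> AP hP; apply/matrixP => a c; rewrite !mxE; apply: eq_bigr => b _.
have [->|/AP/hP/rowP/(_ c)] := eqVneq (A a b) 0; first by rewrite !mul0r.
by rewrite !mxE => ->.
Qed.

(** The homotopy grows by one degree at a time: [x ^+ K - D h] sends a generator of degree [M] to a
    cycle, a power of [x] makes this a boundary, and a bounding chain is the next value of [h]. *)
Lemma contractible_of_torsion (x : S) (M : nat) :
  (forall j (v : 'rV_r), (j < M)%N -> mxdeg (fun=> j) hd 0 0 v -> v *m D = 0 ->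
    exists k w, mxdeg (fun=> j.+1) hd 0 0 w /\ x ^+ k *: v = w *m D) ->
  exists k, contractible_below hd D M (x ^+ k).
Proof.
move=> tors.
(* That [h] vanishes from degree [M] on is carried along so that [h D] drops out of the equation in
   degree [M]. *)
suff [k [h [dh _ hP]]] : exists k h, [/\ mxdeg hd hd 1 0 h,
    (forall b, (M <= hd b)%N -> row b h = 0) &
    forall b, (hd b < M)%N -> row b (D *m h + h *m D) = row b (x ^+ k)%:M].
  by exists k, h.
elim: M tors => [|M IH] tors.
  exists 0%N, 0; split=> //; last by move=> b _; rewrite row0.
  by move=> a b; rewrite mxE eqxx.
have {IH}[|K [h [dh h0 hP]]] := IH.
  by move=> j v lt_j; apply: tors; apply: ltnW.
have [k /fin_all_exists[y yP]] : exists k, forall b, exists y : 'rV_r,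
    mxdeg (fun=> (hd b).+1) hd 0 0 y /\
    if hd b == M then x ^+ k *: row b ((x ^+ K)%:M - D *m h) = y *m D else y = 0.
  have /fin_all_exists[kk kkP] : forall b, exists k, exists y : 'rV_r,
      mxdeg (fun=> (hd b).+1) hd 0 0 y /\
      if hd b == M then x ^+ k *: row b ((x ^+ K)%:M - D *m h) = y *m D else y = 0.
    move=> b; have [hb|_] := eqVneq (hd b) M; last first.
      by exists 0%N, 0; split=> // a c; rewrite mxE eqxx.
    have [||k [w [dw wP]]] := tors M (row b ((x ^+ K)%:M - D *m h)) (ltnSn M).
    - have : mxdeg hd hd 0 0 ((x ^+ K)%:M - D *m h).
        apply: mxdegD; first exact: mxdeg_scalar.
        by apply/mxdegN/(@mxdeg_sub _ _ _ _ _ _ _ 1)/(mxdegM dD dh).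
      by move=> dc a c; rewrite mxE => /dc; rewrite hb.
    - rewrite -row_mul mulmxBl -mulmxA.
      have eq_b : row b (D *m (h *m D)) = row b (D *m (x ^+ K)%:M).
        rewrite !row_mul.
        have <- : row b D *m (D *m h + h *m D) = row b D *m (x ^+ K)%:M.
          apply: (@mulmx_eq_rows _ _ _ _ (fun c => hd c < M)%N) => // a c.
          by rewrite mxE => /dD; lia.
        by rewrite mulmxDr [row b D *m (D *m h)]mulmxA -(row_mul b D D) D2 row0 mul0mx add0r.
      by rewrite raddfB /= eq_b -raddfB /= scalar_mxC subrr row0.
    by exists k, w; rewrite hb.
  (* The sum is one exponent for all indices; its excess over [kk b] is absorbed by [y]. *)
  exists (\sum_b kk b)%N => b; have [y [dy yP]] := kkP b.
  exists (x ^+ (\sum_b kk b - kk b) *: y); split; first exact: mxdegZ.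
  case: ifP yP => [_ yP|_ ->]; last by rewrite scaler0.
  rewrite -scalemxAl -yP scalerA -exprD subnK //.
  by rewrite (bigD1 b) //= leq_addr.
exists (k + K)%N, (x ^+ k *: h + \matrix_b y b); split.
- apply: mxdegD; first exact: mxdegZ.
  move=> a b; rewrite mxE => nz; have [dy _] := yP a.
  by have := dy _ _ nz; lia.
- move=> b lt_M; rewrite raddfD /= linearZ /= h0 ?scaler0 ?add0r; last exact: ltnW.
  by rewrite rowK; have [_] := yP b; rewrite gtn_eqF.
move=> b; rewrite ltnS leq_eqVlt => hb.
have y0 c : hd c != M -> y c = 0 by move=> ne; have [_] := yP c; rewrite (negbTE ne).
have DY : row b (D *m (\matrix_c y c)) = 0.
  rewrite row_mul; transitivity (row b D *m (0 : 'M_r)); last by rewrite mulmx0.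
  apply: (@mulmx_eq_rows _ _ _ _ (fun c => hd c < M)%N) => [a c|c lt_c].
    by rewrite mxE => /dD; lia.
  by rewrite rowK row0 y0 // ltn_eqF.
rewrite mulmxDr mulmxDl -scalemxAl -scalemxAr addrACA -scalerDr.
rewrite raddfD /= linearZ /= [row b (_ + (\matrix_c y c) *m D)]raddfD /= DY add0r.
rewrite [row b ((\matrix_c y c) *m D)]row_mul rowK exprD -scale_scalar_mx linearZ /=.
have [lt_b|ge_b] := ltnP (hd b) M.
  by rewrite hP // y0 ?mul0mx ?addr0 ?ltn_eqF.
have hbM : hd b == M by move: hb; rewrite ltnNge ge_b orbF.
have [_] := yP b; rewrite hbM => <-.
rewrite -scalerDr [row b (_ + h *m D)]raddfD /= [row b (h *m D)]row_mul h0 //.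
rewrite mul0mx addr0.
by congr (_ *: _); rewrite -raddfD /= addrC subrK.
Qed.

End Contraction.

(** * Tensor powers *)

Fixpoint tpow_dim (r t : nat) : nat :=
  if t is t'.+1 then (r * tpow_dim r t')%N else 1%N.

Fixpoint tpow_grading r (f : 'I_r -> nat) (t : nat) : 'I_(tpow_dim r t) -> nat :=
  if t is t'.+1 then tens_grading f (@tpow_grading r f t') else fun=> 0%N.
Arguments tpow_grading {r} f t _.

Section TensorVectors.
Variable S : comNzRingType.

Definition tensrow m n (v : 'rV[S]_m) (w : 'rV[S]_n) : 'rV[S]_(m * n) :=
  \row_k (v 0 (mxtens_unindex k).1 * w 0 (mxtens_unindex k).2).

Definition tenscol m n (v : 'cV[S]_m) (w : 'cV[S]_n) : 'cV[S]_(m * n) :=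
  \col_k (v (mxtens_unindex k).1 0 * w (mxtens_unindex k).2 0).

Lemma tensrow_mul m n m' n' (v : 'rV_m) (w : 'rV_n) (A : 'M_(m, m'))
    (B : 'M_(n, n')) :
  tensrow v w *m (A *t B) = tensrow (v *m A) (w *m B).
Proof.
apply/rowP => k; case: (mxtens_indexP k) => k1 k2.
rewrite !mxE !mxtens_indexK mulr_sum; apply: congr_big => // j _.
by rewrite !mxE !mxtens_indexK mulrACA.
Qed.

Lemma tenscol_mul m n m' n' (v : 'cV_m) (w : 'cV_n) (A : 'M_(m', m))
    (B : 'M_(n', n)) :
  (A *t B) *m tenscol v w = tenscol (A *m v) (B *m w).
Proof.
apply/colP => k; case: (mxtens_indexP k) => k1 k2.
rewrite !mxE !mxtens_indexK mulr_sum; apply: congr_big => // j _.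
by rewrite !mxE !mxtens_indexK mulrACA.
Qed.

Lemma tensrow_col m n (v : 'rV_m) (w : 'rV_n) (a : 'cV_m) (b : 'cV_n) :
  tensrow v w *m tenscol a b = (v *m a) *m (w *m b).
Proof.
apply/rowP => k; rewrite [k]ord1 !mxE big_ord1 !mxE mulr_sum.
by apply: congr_big => // j _; rewrite !mxE mulrACA.
Qed.

Lemma tensrowZl m n a (v : 'rV_m) (w : 'rV_n) :
  tensrow (a *: v) w = a *: tensrow v w.
Proof. by apply/rowP => k; rewrite !mxE mulrA. Qed.

Lemma tensrowZr m n a (v : 'rV_m) (w : 'rV_n) :
  tensrow v (a *: w) = a *: tensrow v w.
Proof. by apply/rowP => k; rewrite !mxE mulrCA. Qed.

Lemma tensrow0 m n (w : 'rV_n) : tensrow (0 : 'rV_m) w = 0.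
Proof. by apply/rowP => k; rewrite !mxE mul0r. Qed.

Lemma tensrow_diff m n (hd : 'I_m -> nat) j (v : 'rV_m) (w : 'rV_n)
    (D : 'M_m) (D' : 'M_n) : mxdeg (fun=> j) hd 0 0 v ->
  tensrow v w *m tens_diff hd D D' =
  tensrow (v *m D) w + (-1) ^+ j *: tensrow v (w *m D').
Proof.
move=> dv; rewrite mulmxDr !tensrow_mul mulmx1 -tensrowZl; congr (_ + tensrow _ _).
apply/rowP => b; rewrite mul_mx_diag !mxE.
have [->|/dv] := eqVneq (v 0 b) 0; first by rewrite mul0r mulr0.
by rewrite !addn0 => ->; rewrite mulrC.
Qed.

Lemma tenscol_diff m n (hd : 'I_m -> nat) j (v : 'cV_m) (w : 'cV_n)
    (D : 'M_m) (D' : 'M_n) : mxdeg hd (fun=> j) 0 0 v ->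
  tens_diff hd D D' *m tenscol v w =
  tenscol (D *m v) w + (-1) ^+ j *: tenscol v (D' *m w).
Proof.
move=> dv; rewrite mulmxDl !tenscol_mul mul1mx; congr (_ + _).
apply/colP => b; rewrite mxE mul_diag_mx !mxE mulrA.
have [->|/dv] := eqVneq (v (mxtens_unindex b).1 0) 0; first by rewrite !(mulr0, mul0r).
by rewrite !addn0 => ->.
Qed.

Lemma tensrow_deg m n (hd : 'I_m -> nat) (hd' : 'I_n -> nat) j j'
    (v : 'rV_m) (w : 'rV_n) :
  mxdeg (fun=> j) hd 0 0 v -> mxdeg (fun=> j') hd' 0 0 w ->
  mxdeg (fun=> j + j')%N (tens_grading hd hd') 0 0 (tensrow v w).
Proof.
move=> dv dw a k; rewrite mxE /tens_grading => nz.
have /dv e1 : v 0 (mxtens_unindex k).1 != 0.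
  by apply: contraNneq nz => ->; rewrite mul0r.
have /dw e2 : w 0 (mxtens_unindex k).2 != 0.
  by apply: contraNneq nz => ->; rewrite mulr0.
lia.
Qed.

Variables (r : nat) (hd : 'I_r -> nat) (D : 'M[S]_r).

Fixpoint tpow_diff (t : nat) : 'M[S]_(tpow_dim r t) :=
  if t is t'.+1 then tens_diff hd D (tpow_diff t') else 0.

(** With the generator [o] of S as padding, this moves a chain into a larger tensor power without
    changing its bidegree. *)
Fixpoint tpad_row (u : 'rV[S]_r) (q k : nat) (x : 'rV[S]_(tpow_dim r k)) :
    'rV[S]_(tpow_dim r (q + k)) :=
  if q is q'.+1 then tensrow u (tpad_row u q' x) else x.

Fixpoint tpad_col (u : 'cV[S]_r) (q k : nat) (x : 'cV[S]_(tpow_dim r k)) :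
    'cV[S]_(tpow_dim r (q + k)) :=
  if q is q'.+1 then tenscol u (tpad_col u q' x) else x.

Fixpoint tpow_row (u : 'rV[S]_r) (k : nat) : 'rV[S]_(tpow_dim r k) :=
  if k is k'.+1 then tensrow u (tpow_row u k') else 1%:M.

Fixpoint tpow_col (u : 'cV[S]_r) (k : nat) : 'cV[S]_(tpow_dim r k) :=
  if k is k'.+1 then tenscol u (tpow_col u k') else 1%:M.

(* If [u D = v o], then [u^(x)k] has differential [v] times this cycle. *)
Fixpoint tpow_cycle (o u : 'rV[S]_r) (k : nat) : 'rV[S]_(tpow_dim r k) :=
  if k is k'.+1 then tensrow o (tpow_row u k') - tensrow u (tpow_cycle o u k')
  else 0.

Hypotheses (dD : mxdeg hd hd 0 1 D) (D2 : D *m D = 0).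

Lemma tpow_diff_deg t :
  mxdeg (tpow_grading hd t) (tpow_grading hd t) 0 1 (tpow_diff t).
Proof.
elim: t => [|t IH] /=; last exact: tens_diff_deg.
by move=> a b; rewrite mxE eqxx.
Qed.

Lemma tpow_diff_sq t : tpow_diff t *m tpow_diff t = 0.
Proof. by elim: t => [|t IH] /=; [rewrite mul0mx | exact: tens_diff_sq]. Qed.

Lemma tpow_contractible M s t : contractible_below hd D M s ->
  contractible_below (tpow_grading hd t) (tpow_diff t) (t * M) (s ^+ t).
Proof.
move=> cD; elim: t => [|t IH]; last first.
  by rewrite exprS mulSn; apply: contractible_tens.
by exists 0 => // a b; rewrite mxE eqxx.
Qed.

Variables (o u : 'rV[S]_r) (b : 'cV[S]_r) (v : S).
Hypotheses (ho : mxdeg (fun=> 0%N) hd 0 0 o) (hu : mxdeg (fun=> 1%N) hd 0 0 u).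
Hypotheses (hb : mxdeg hd (fun=> 0%N) 0 0 b).
Hypotheses (oD : o *m D = 0) (uD : u *m D = v *: o) (ob : o *m b = 1%:M).

(** In the application [b] is the coordinate of S, and [a] is the augmentation of L_0 extended by
    zero. *)
Let a : 'cV[S]_r := D *m b.

Lemma tpow_row_diff k :
  tpow_row u k *m tpow_diff k = v *: tpow_cycle o u k.
Proof.
elim: k => [|k IH] /=; first by rewrite mulmx0 scaler0.
rewrite (tensrow_diff _ _ _ hu) uD IH tensrowZl tensrowZr expr1 scaleN1r.
by rewrite scalerBr.
Qed.

(** Expanded directly: [v] may be zero, so it cannot be cancelled from the vanishing of the squared
    differential on [tpow_row u k]. *)
Lemma tpow_cycle_diff k : tpow_cycle o u k *m tpow_diff k = 0.
Proof.
elim: k => [|k IH] /=; first by rewrite mul0mx.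
rewrite mulmxBl (tensrow_diff _ _ _ ho) (tensrow_diff _ _ _ hu) oD uD IH.
rewrite tpow_row_diff tensrow0 add0r expr0 scale1r !tensrowZl tensrowZr.
suff -> : tensrow u (0 : 'rV_(tpow_dim r k)) = 0 by rewrite scaler0 addr0 subrr.
by apply/rowP => i; rewrite !mxE mulr0.
Qed.

Lemma tpad_cycle_diff q k : tpad_row o q (tpow_cycle o u k) *m tpow_diff (q + k) = 0.
Proof.
elim: q => [|q IH] /=; first exact: tpow_cycle_diff.
rewrite (tensrow_diff _ _ _ ho) oD IH tensrow0 add0r.
by apply/rowP => i; rewrite !mxE !mulr0.
Qed.

Lemma tpow_row_deg k : mxdeg (fun=> k) (tpow_grading hd k) 0 0 (tpow_row u k).
Proof. by elim: k => [|k IH] //=; rewrite -[k.+1]add1n; apply: tensrow_deg. Qed.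

Lemma tpow_cycle_deg k :
  mxdeg (fun=> k) (tpow_grading hd k.+1) 0 0 (tpow_cycle o u k.+1).
Proof.
elim: k => [|k IH] /=.
  apply: mxdegD; first exact: (tensrow_deg ho (@tpow_row_deg 0)).
  by move=> i j; rewrite !mxE mulr0 oppr0 eqxx.
apply: mxdegD; first exact: (tensrow_deg ho (@tpow_row_deg k.+1)).
by apply: mxdegN; apply: (tensrow_deg hu IH).
Qed.

Lemma tpad_row_deg q k j x : mxdeg (fun=> j) (tpow_grading hd k) 0 0 x ->
  mxdeg (fun=> j) (tpow_grading hd (q + k)) 0 0 (tpad_row o q x).
Proof. by move=> dx; elim: q => [|q IH] //=; apply: (tensrow_deg ho IH). Qed.

Lemma ha : mxdeg hd (fun=> 1%N) 0 0 a.
Proof.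
by apply: (@mxdeg_sub _ _ _ _ _ _ _ 0); move=> i j /(mxdegM dD hb); lia.
Qed.

Lemma tpow_diff_col k : tpow_diff k *m tpow_col a k = 0.
Proof.
elim: k => [|k IH] /=; first by rewrite mul0mx.
rewrite (tenscol_diff _ _ _ ha) IH /a mulmxA D2 mul0mx.
by apply/colP => i; rewrite !mxE !(mul0r, mulr0) addr0.
Qed.

Lemma tpow_row_col k : tpow_row u k *m tpow_col a k = (v ^+ k)%:M.
Proof.
elim: k => [|k IH] /=; first by rewrite mul1mx.
rewrite tensrow_col IH /a mulmxA uD -scalemxAl ob exprS -scale_scalar_mx.
by rewrite -scalemxAl mul1mx.
Qed.

(** Only the summand o (x) u^(x)k of the cycle survives: elsewhere [u] meets [b], which sits in
    another degree. Each [u] that meets [a] gives u D b = v. *)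
Lemma tpad_cycle_col q k :
  tpad_row o q (tpow_cycle o u k.+1) *m
    tpad_col b q (tenscol b (tpow_col a k) : 'cV_(tpow_dim r k.+1)) =
  (v ^+ k)%:M.
Proof.
elim: q => [|q IH] /=; last by rewrite tensrow_col IH ob mul1mx.
rewrite mulmxBl !tensrow_col tpow_row_col ob mul1mx.
suff -> : u *m b = 0 by rewrite mul0mx subr0.
apply/rowP => i; rewrite !mxE big1 // => j _.
have [->|/hu e1] := eqVneq (u 0 j) 0; first by rewrite mul0r.
have [->|/hb e2] := eqVneq (b j i) 0; first by rewrite mulr0.
lia.
Qed.

End TensorVectors.

(** * Internal degrees in tensor powers *)

Section Homogeneity.
Variables (N : nat) (K : comNzRingType).
Local Notation S := {mpoly K[N]}.

Lemma mx_homogD m n (f : 'I_m -> nat) (g : 'I_n -> nat) (A B : 'M[S]_(m, n)) :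
  mx_homog f g A -> mx_homog f g B -> mx_homog f g (A + B).
Proof.
by move=> hA hB i j mo; rewrite mxE => /msuppD_le; rewrite mem_cat => /orP[/hA|/hB].
Qed.

Lemma mx_homogZ m n (f : 'I_m -> nat) (g : 'I_n -> nat) e a (A : 'M[S]_(m, n)) :
  a \is e.-homog -> mx_homog f g A -> mx_homog (fun i => e + f i)%N g (a *: A).
Proof.
move=> /dhomogP ha hA i j mo; rewrite mxE => /mem_msuppM[m1 [m2 [/ha e1 /hA e2 ->]]].
by rewrite mdegD e1 -addnA e2.
Qed.

Lemma mx_homogN m n (f : 'I_m -> nat) (g : 'I_n -> nat) (A : 'M[S]_(m, n)) :
  mx_homog f g A -> mx_homog f g (- A).
Proof. by move=> hA i j mo; rewrite mxE (perm_mem (msuppN _)) => /hA. Qed.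

Lemma mx_homog_const m n (f : 'I_m -> nat) (g : 'I_n -> nat) (A : 'M[S]_(m, n))
    (c : 'I_m -> 'I_n -> K) :
  (forall i j, A i j = (c i j)%:MP) -> (forall i j, c i j != 0 -> f i = g j) ->
  mx_homog f g A.
Proof.
move=> AE fg i j mo; rewrite AE msuppC; case: eqP => // /eqP/fg e.
by rewrite inE => /eqP ->; rewrite mdeg0 add0n e.
Qed.

Lemma mx_homogT m n m' n' (f : 'I_m -> nat) (g : 'I_n -> nat) (f' : 'I_m' -> nat)
    (g' : 'I_n' -> nat) (A : 'M[S]_(m, n)) (B : 'M[S]_(m', n')) :
  mx_homog f g A -> mx_homog f' g' B ->
  mx_homog (tens_grading f f') (tens_grading g g') (A *t B).
Proof.
move=> hA hB i j mo; rewrite mxE => /mem_msuppM[m1 [m2 [/hA e1 /hB e2 ->]]].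
by rewrite mdegD /tens_grading -e1 -e2 addnACA.
Qed.

Lemma mx_homog_diag m (f : 'I_m -> nat) (v : 'rV[K]_m) :
  mx_homog f f (diag_mx (map_mx (@mpolyC N K) v)).
Proof.
apply: (@mx_homog_const _ _ _ _ _ (fun i j => if i == j then v 0 i else 0)).
  by move=> i j; rewrite !mxE; case: eqP => [->|_]; rewrite ?mpolyC0.
by move=> i j; have [->|_] := eqVneq i j; rewrite ?eqxx.
Qed.

Lemma tpow_diff_homog r (hd tw : 'I_r -> nat) (D : 'M[S]_r) t :
  mx_homog tw tw D ->
  mx_homog (tpow_grading tw t) (tpow_grading tw t) (tpow_diff hd D t).
Proof.
move=> hD; elim: t => [|t IH] /=; first by move=> i j mo; rewrite mxE msupp0.
apply: mx_homogD; apply: mx_homogT => //.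
  have -> : 1%:M = diag_mx (map_mx (@mpolyC N K) (const_mx 1)) :> 'M[S]_(tpow_dim r t).
    by apply/matrixP => i j; rewrite !mxE.
  exact: mx_homog_diag.
have -> : parity_mx _ hd = diag_mx (map_mx (@mpolyC N K) (\row_b (-1) ^+ hd b)).
  apply/matrixP => i j; rewrite !mxE; congr (_ *+ _).
  by rewrite rmorphXn rmorphN1.
exact: mx_homog_diag.
Qed.

Lemma tensrow_homog m n (f : 'I_m -> nat) (g : 'I_n -> nat) e e'
    (v : 'rV[S]_m) (w : 'rV[S]_n) :
  mx_homog (fun=> e) f v -> mx_homog (fun=> e') g w ->
  mx_homog (fun=> e + e')%N (tens_grading f g) (tensrow v w).
Proof.
move=> hv hw i j mo; rewrite mxE => /mem_msuppM[m1 [m2 [/hv e1 /hw e2 ->]]].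
by rewrite mdegD /tens_grading addnACA e1 e2.
Qed.

Lemma tpad_row_homog r (tw : 'I_r -> nat) (o : 'rV[S]_r) q k e x :
  mx_homog (fun=> 0%N) tw o -> mx_homog (fun=> e) (tpow_grading tw k) x ->
  mx_homog (fun=> e) (tpow_grading tw (q + k)) (tpad_row o q x).
Proof. by move=> ho hx; elim: q => [|q IH] //=; apply: (tensrow_homog ho IH). Qed.

Lemma tpow_row_homog r (tw : 'I_r -> nat) (u : 'rV[S]_r) d k :
  mx_homog (fun=> d) tw u ->
  mx_homog (fun=> k * d)%N (tpow_grading tw k) (tpow_row u k).
Proof.
move=> hu; elim: k => [|k IH] /=; last by rewrite mulSn; apply: tensrow_homog.
apply: (@mx_homog_const _ _ _ _ _ (fun i j => (i == j)%:R)) => // i j.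
by rewrite mxE rmorph_nat.
Qed.

Lemma tpow_cycle_homog r (tw : 'I_r -> nat) (o u : 'rV[S]_r) d k :
  mx_homog (fun=> 0%N) tw o -> mx_homog (fun=> d) tw u ->
  mx_homog (fun=> k * d)%N (tpow_grading tw k.+1) (tpow_cycle o u k.+1).
Proof.
move=> ho hu; elim: k => [|k IH] /=.
  apply: mx_homogD; first exact: (tensrow_homog ho (@tpow_row_homog _ _ _ d 0 hu)).
  by apply: mx_homogN => i j mo; rewrite !mxE mulr0 msupp0.
apply: mx_homogD; first exact: (tensrow_homog ho (@tpow_row_homog _ _ _ d k.+1 hu)).
by rewrite mulSn; apply: mx_homogN; apply: (tensrow_homog hu IH).
Qed.

End Homogeneity.

(** * Powers of an ideal and the passage from exponent k to k + 1 *)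

Section IdealPowers.
Variables (K : fieldType) (n : nat).
Local Notation S := {mpoly K[n.+1]}.
Implicit Types (I J : S -> Prop).

Definition ideal_closed J : Prop :=
  [/\ J 0, forall x y, J x -> J y -> J (x + y) & forall c x, J x -> J (c * x)].

Lemma ideal_gen_closed A : ideal_closed (@ideal_gen K n A).
Proof.
split.
- by exists 0%N, (fun=> 0), (fun=> 0); split; [case | rewrite big_ord0].
- move=> _ _ [k [c [a [Aa ->]]]] [k' [c' [a' [Aa' ->]]]].
  exists (k + k')%N, (fun i => match split i with inl j => c j | inr j => c' j end),
    (fun i => match split i with inl j => a j | inr j => a' j end); split.
    by move=> i; case: (split i).
  rewrite big_split_ord /=; congr (_ + _); apply: eq_bigr => j _.
    by rewrite (unsplitK (inl j)).
  by rewrite (unsplitK (inr j)).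
move=> c _ [k [c' [a [Aa ->]]]]; exists k, (fun i => c * c' i), a; split=> //.
by rewrite mulr_sumr; apply: eq_bigr => i _; rewrite mulrA.
Qed.

Lemma ideal_gen_mem A x : A x -> @ideal_gen K n A x.
Proof.
by move=> Ax; exists 1%N, (fun=> 1), (fun=> x); rewrite big_ord1 mul1r.
Qed.

Lemma ideal_gen_min A J x :
  ideal_closed J -> (forall y, A y -> J y) -> @ideal_gen K n A x -> J x.
Proof.
move=> [J0 JD JM] AJ [k [c [a [Aa ->]]]].
by elim/big_ind: _ => // i _; apply/JM/AJ.
Qed.

Lemma ideal_closed_sum J (T : Type) (s : seq T) (P : pred T) (F : T -> S) :
  ideal_closed J -> (forall i, P i -> J (F i)) -> J (\sum_(i <- s | P i) F i).
Proof. by case=> J0 JD _ JF; elim/big_ind: _. Qed.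

Lemma ideal_pow_closed I k : ideal_closed (ideal_pow I k).
Proof. by case: k => [|k]; [split | apply: ideal_gen_closed]. Qed.

Lemma ideal_powS I k x y : I x -> ideal_pow I k y -> ideal_pow I k.+1 (x * y).
Proof. by move=> Ix Iy; apply: ideal_gen_mem; exists x, y. Qed.

Lemma ideal_closed_mulmx J m1 m2 m3 (A : 'M[S]_(m1, m2)) (B : 'M[S]_(m2, m3)) :
  ideal_closed J -> (forall i j, J (B i j)) -> forall i j, J ((A *m B) i j).
Proof.
move=> JI JB i j; rewrite mxE; apply: ideal_closed_sum => // l _.
by case: JI => _ _; apply.
Qed.

Section PowerStep.
Variables (d p r : nat) (hd tw : 'I_r -> nat) (D : 'M[S]_r).
Variables (o : 'rV[S]_r) (b : 'cV[S]_r) (I : S -> Prop).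
Hypotheses (dD : mxdeg hd hd 0 1 D) (D2 : D *m D = 0) (hD : mx_homog tw tw D).
Hypothesis cD : forall l : 'I_n.+1,
  exists k, contractible_below hd D p.+1 ('X_l ^+ k).
Hypothesis tw_le : forall i, (tw i < d + hd i)%N.
Hypotheses (ho : mxdeg (fun=> 0%N) hd 0 0 o) (hto : mx_homog (fun=> 0%N) tw o).
Hypotheses (hb : mxdeg hd (fun=> 0%N) 0 0 b).
Hypotheses (oD : o *m D = 0) (ob : o *m b = 1%:M).
Hypothesis ID : forall i j, I ((D *m b) i j).

Let a : 'cV[S]_r := D *m b.

(** The strict inequality [tw_le] gains one in each factor, whence the summand [t]. *)
Lemma tpow_tw_le t i : (tpow_grading tw t i + t <= t * d + tpow_grading hd t i)%N.
Proof.
elim: t i => [|t IH] i //.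
pose c := mxtens_unindex (i : 'I_(r * tpow_dim r t)).
change (tw c.1 + tpow_grading tw t c.2 + t.+1 <=
  t.+1 * d + (hd c.1 + tpow_grading hd t c.2))%N.
by have := IH c.2; have := tw_le c.1; lia.
Qed.

Lemma tpow_col_ideal k i j : ideal_pow I k (tpow_col a k i j).
Proof. by elim: k i j => [|k IH] i j //=; rewrite mxE; apply: ideal_powS. Qed.

Lemma tpad_col_ideal q k i j :
  ideal_pow I k (tpad_col b q (tenscol b (tpow_col a k) : 'cV_(tpow_dim r k.+1)) i j).
Proof.
have [_ _ IM] := ideal_pow_closed I k.
elim: q i j => [|q IH] i j /=; rewrite mxE; apply: IM => //.
exact: tpow_col_ideal.
Qed.

(** The differential turns one copy of [b] into [a], whose entries lie in [I], and it kills [a]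
    because D D = 0. Next to the [k] copies of [a] a further factor from [I] thus appears. *)
Lemma tpad_col_diff_ideal q k i j :
  ideal_pow I k.+1 ((tpow_diff hd D (q + k.+1) *m
    tpad_col b q (tenscol b (tpow_col a k) : 'cV_(tpow_dim r k.+1))) i j).
Proof.
have [_ IA IM] := ideal_pow_closed I k.+1.
elim: q i j => [|q IH] i j.
  rewrite (tenscol_diff _ _ _ hb) (tpow_diff_col dD D2 hb) mxE; apply: IA.
    by rewrite mxE; apply: ideal_powS; [apply: ID | apply: tpow_col_ideal].
  by rewrite !mxE !mulr0; case: (ideal_pow_closed I k.+1).
rewrite /= (tenscol_diff _ _ _ hb) mxE; apply: IA.
  by rewrite mxE; apply: ideal_powS; [apply: ID | apply: tpad_col_ideal].
by rewrite mxE; apply: (IM); rewrite mxE; apply: IM.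
Qed.

(* [g] times the cycle attached to [v] bounds in the tensor power; pairing the
   bounding chain with the functional that evaluates the cycle to [v ^+ k]
   lands in [I^(k+1)]. *)
Lemma power_step t k (u : 'rV[S]_r) (v g : S) :
  (n <= t * p)%N -> (k < t)%N ->
  mxdeg (fun=> 1%N) hd 0 0 u -> mx_homog (fun=> d) tw u -> u *m D = v *: o ->
  g \is ((t - k) * d).-homog -> ideal_pow I k.+1 (g * v ^+ k).
Proof.
move=> le_n lt_k hu htu uD hg.
have et : t = (t - k.+1 + k.+1)%N by rewrite subnK.
move: (t - k.+1)%N et => q et; subst t.
pose z : 'rV_(tpow_dim r (q + k.+1)) := g *: tpad_row o q (tpow_cycle o u k.+1).
have [|||||||||w zE] := @homology_vanishing _ _ _ (tpow_grading hd (q + k.+1))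
    (tpow_grading tw (q + k.+1)) (tpow_diff hd D (q + k.+1)) _ _ _
    ((q + k.+1) * p.+1) ((q + k.+1) * d) k _ _ _ z.
- exact: tpow_diff_deg.
- exact: tpow_diff_sq.
- exact: tpow_diff_homog.
- move=> l; have [j cj] := cD l; exists (j * (q + k.+1))%N.
  by rewrite exprM; apply: tpow_contractible.
- by rewrite mulnS; lia.
- move=> i hi; have := @tpow_tw_le (q + k.+1) i; rewrite hi; lia.
- by apply/mxdegZ/(tpad_row_deg ho)/tpow_cycle_deg.
- have hz := @tpad_row_homog _ _ _ _ o q _ _ _ hto
    (@tpow_cycle_homog _ _ _ _ o u d k hto htu).
  have hz' := mx_homogZ hg hz.
  have e1 : ((q + k.+1 - k) * d + k * d = (q + k.+1) * d)%N.
    by rewrite -mulnDl subnK // ltnW.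
  by rewrite -e1.
- by rewrite -scalemxAl (tpad_cycle_diff ho hu oD uD) scaler0.
have -> : g * v ^+ k = (z *m
    tpad_col b q (tenscol b (tpow_col a k) : 'cV_(tpow_dim r k.+1))) 0 0.
  by rewrite -scalemxAl (tpad_cycle_col hu hb uD ob) !mxE mulr1n.
rewrite zE -mulmxA; apply: ideal_closed_mulmx; first exact: ideal_pow_closed.
exact: tpad_col_diff_ideal.
Qed.

End PowerStep.
End IdealPowers.

(** * Powers of ideals *)

Section Polarization.
Variables (K : numFieldType) (n : nat).
Local Notation S := {mpoly K[n.+1]}.
Implicit Types (J V : S -> Prop).

(** The nodes 0, ..., N - 1 are distinct in characteristic zero, so inverting their Vandermonde
    matrix writes each coefficient as a combination of values. *)
Lemma ideal_closed_coef J N (c : 'I_N -> S) : ideal_closed J ->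
  (forall x : K, J (\sum_(i < N) x ^+ i *: c i)) -> forall i, J (c i).
Proof.
move=> JI Jc i; have [_ _ JM] := JI.
pose a : 'rV[K]_N := \row_j j%:R; pose A := Vandermonde N a.
have uA : A \in unitmx.
  rewrite unitmxE det_Vandermonde unitfE; apply/prodf_neq0 => j _.
  apply/prodf_neq0 => l lt_jl; rewrite !mxE subr_eq0 eqr_nat.
  by rewrite gtn_eqF.
have -> : c i = \sum_j (invmx A) j i *: \sum_(l < N) (a 0 j) ^+ l *: c l.
  transitivity (\sum_l (A *m invmx A) l i *: c l).
    rewrite mulmxV // (bigD1 i) //= mxE eqxx scale1r big1 ?addr0 // => l ne.
    by rewrite mxE (negbTE ne) scale0r.
  under [RHS]eq_bigr => j _ do rewrite scaler_sumr.
  rewrite exchange_big; apply: eq_bigr => l _ /=.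
  rewrite mxE scaler_suml; apply: eq_bigr => j _.
  by rewrite scalerA !mxE mulrC.
apply: ideal_closed_sum => // j _; rewrite -mul_mpolyC; exact: JM.
Qed.

(** One factor is split off at a time: the coefficient of x in h (w + x v_0)^(k+1) is (k + 1) h v_0
    w^k, and k + 1 is invertible. *)
Lemma ideal_closed_polar J V k (h : S) (v : nat -> S) : ideal_closed J -> V 0 ->
  (forall (x : K) u w, V u -> V w -> V (u + x *: w)) ->
  (forall w, V w -> J (h * w ^+ k)) -> (forall i, V (v i)) ->
  J (h * \prod_(i < k) v i).
Proof.
move=> JI V0 VD; elim: k h v => [|k IH] h v Jh Vv.
  by rewrite big_ord0; have := Jh 0 V0; rewrite expr0.
rewrite big_ord_recl mulrA; apply: (IH _ (fun i => v i.+1)) => // w Vw.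
pose c (i : 'I_k.+2) := h * (w ^+ (k.+1 - i) * v 0%N ^+ i) *+ 'C(k.+1, i).
have Jc : J (c (inord 1)).
  apply: ideal_closed_coef => // x.
  have -> : \sum_(i < k.+2) x ^+ i *: c i = h * (w + x *: v 0%N) ^+ k.+1.
    rewrite exprDn mulr_sumr; apply: eq_bigr => i _.
    by rewrite exprZn -scalerAr scalerMnr -scalerAr mulrnAr.
  by apply/Jh/VD.
have [_ _ JM] := JI.
suff -> : h * v 0%N * w ^+ k = (k.+1%:R^-1)%:MP * c (inord 1) by apply: JM.
rewrite /c inordK // subSS subn0 bin1 expr1 mul_mpolyC.
rewrite -scaler_nat scalerA mulVf ?scale1r; last by rewrite pnatr_eq0.
by rewrite mulrA mulrAC.
Qed.

End Polarization.

(** * Powers of the irrelevant ideal; generators of powers *)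

Section Degrees.
Variables (K : fieldType) (n : nat).
Local Notation S := {mpoly K[n.+1]}.
Implicit Types (I J V : S -> Prop).

(** The support form of membership in the k-th power of the irrelevant ideal, by
    [irrelevant_powP]. *)
Definition mindeg (k : nat) (g : S) : Prop :=
  forall m, m \in msupp g -> (k <= mdeg m)%N.

Lemma mindegM j k f g : mindeg j f -> mindeg k g -> mindeg (j + k) (f * g).
Proof.
move=> df dg m /mem_msuppM[m1 [m2 [/df d1 /dg d2 ->]]].
by rewrite mdegD leq_add.
Qed.

Lemma mindeg_closed k : ideal_closed (mindeg k).
Proof.
split; first by move=> m; rewrite msupp0.
  by move=> f g df dg m /msuppD_le; rewrite mem_cat => /orP[/df|/dg].
by move=> c f df; rewrite -[k]add0n; apply: mindegM.
Qed.

Lemma mindeg_homog k f : f \is k.-homog -> mindeg k f.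
Proof. by move=> /dhomogP hf m /hf ->. Qed.

Lemma mindeg_pow I k t g :
  (forall f, I f -> mindeg k f) -> ideal_pow I t g -> mindeg (t * k) g.
Proof.
move=> dI; elim: t g => [|t IH] g //=.
apply: ideal_gen_min; first exact: mindeg_closed.
by move=> _ [f [h [/dI df /IH dh ->]]]; rewrite mulSn; apply: mindegM.
Qed.

Lemma mnm_pos (m : 'X_{1..n.+1}) : (0 < mdeg m)%N ->
  exists i m', m = (U_(i) + m')%MM.
Proof.
rewrite lt0n mdeg_eq0 => nz.
have [/existsP[i mi]|/existsPn no] := boolP [exists i, m i != 0%N].
  exists i, (m - U_(i))%MM; rewrite addmC submK //; apply/mnm_lepP => j.
  by rewrite mnm1E; have [<-|//] := eqVneq i j; rewrite lt0n.
by case/eqP: nz; apply/mnmP => i; rewrite mnm0E; apply/eqP; have := no i; rewrite negbK.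
Qed.

Lemma mindeg_ind J k g : ideal_closed J ->
  (forall m, mdeg m = k -> J 'X_[m]) -> mindeg k g -> J g.
Proof.
move=> JI JX dg; have [J0 JD JM] := JI.
have {}JX c m : mdeg m = (c + k)%N -> J 'X_[m].
  elim: c m => [|c IH] m dm; first exact: JX.
  have [|i [m' em]] := @mnm_pos m; first by rewrite dm.
  rewrite em mpolyXD; apply/JM/IH; move: dm; rewrite em mdegD mdeg1; lia.
rewrite [g]mpolyE big_seq; apply: ideal_closed_sum => // m /dg le_k.
by rewrite -mul_mpolyC; apply/JM/(JX (mdeg m - k)%N); rewrite subnK.
Qed.

Lemma irrelevant_powP k (g : S) :
  ideal_pow (@irrelevant_ideal K n) k g <-> mindeg k g.
Proof.
split=> [|dg].
  rewrite -{2}[k]muln1; apply: mindeg_pow => f.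
  apply: ideal_gen_min; first exact: mindeg_closed.
  by move=> _ [i ->] m; rewrite msuppX inE => /eqP ->; rewrite mdeg1.
apply: mindeg_ind dg; first exact: ideal_pow_closed.
elim: k => [|k IH] m dm //.
have [|i [m' em]] := @mnm_pos m; first by rewrite dm.
rewrite em mpolyXD; apply: ideal_powS; first by apply: ideal_gen_mem; exists i.
by apply: IH; move: dm; rewrite em mdegD mdeg1; lia.
Qed.

Lemma ideal_pow_gen I V k x : V 0 -> (forall f, I f -> ideal_gen V f) ->
  ideal_pow I k x ->
  ideal_gen (fun h => exists2 v : nat -> S,
    (forall i, V (v i)) & h = \prod_(i < k) v i) x.
Proof.
move=> V0 genV; elim: k x => [|k IH] x /=.
  move=> _; rewrite -[x]mulr1; set G := ideal_gen _.
  have [_ _ GM] : ideal_closed G by apply: ideal_gen_closed.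
  by apply: GM; apply: ideal_gen_mem; exists (fun=> 0); rewrite ?big_ord0.
apply: ideal_gen_min; first exact: ideal_gen_closed.
move=> _ [f [g [/genV Vf /IH Pg ->]]].
set G := ideal_gen _; have GI : ideal_closed G by apply: ideal_gen_closed.
have [G0 GD GM] := GI.
apply: (@ideal_gen_min _ _ V (fun f => G (f * g))) Vf.
  split; first by rewrite mul0r.
    by move=> a b Ga Gb; rewrite mulrDl; apply: GD.
  by move=> c a Ga; rewrite -mulrA; apply: GM.
move=> a Va; apply: (@ideal_gen_min _ _ _ (fun b => G (a * b))) Pg.
  split; first by rewrite mulr0.
    by move=> b c Gb Gc; rewrite mulrDr; apply: GD.
  by move=> c b Gb; rewrite mulrCA; apply: GM.
move=> _ [v Vv ->]; apply: ideal_gen_mem.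
exists (fun i => if i is j.+1 then v j else a); first by case.
by rewrite big_ord_recl.
Qed.
(** Projecting an expression of [x] through k-fold products to degree e + k d replaces each
    coefficient by its component of degree [e]. *)
Lemma dhomog_pow_mem I V d k e x : V 0 -> (forall f, I f -> ideal_gen V f) ->
  (forall v, V v -> v \is d.-homog) -> ideal_pow I k x ->
  x \is (e + k * d).-homog ->
  forall J, ideal_closed J ->
  (forall c (v : nat -> S), c \is e.-homog -> (forall i, V (v i)) ->
     J (c * \prod_(i < k) v i)) ->
  J x.
Proof.
move=> V0 genV dV /(ideal_pow_gen V0 genV)[N [c [a [aE ->]]]] hx J JI JP.
rewrite -(pihomog_dE hx) raddf_sum /=; apply: ideal_closed_sum => // i _.
have [v Vv ->] := aE i; rewrite pihomogM; first exact: JP (pihomogP _ _ _) Vv.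
elim: k {aE hx JP} => [|k IH]; first by rewrite big_ord0 dhomog1.
by rewrite big_ord_recr /= mulSn addnC; apply: dhomogM => //; apply: dV.
Qed.

End Degrees.

(** * Climbing from exponent 0 to exponent t *)

Section PowersOfTheIdeal.
Variables (K : numFieldType) (n d t : nat) (I : {mpoly K[n.+1]} -> Prop).
Local Notation V := (fun v => I v /\ v \is d.-homog).
Hypotheses (II : ideal_closed I) (genV : forall f, I f -> ideal_gen V f).
Hypothesis stepV : forall k v g, (k < t)%N -> V v ->
  g \is ((t - k) * d).-homog -> ideal_pow I k.+1 (g * v ^+ k).

Lemma dhomog_ideal_pow k g :
  (k <= t)%N -> g \is (t * d).-homog -> ideal_pow I k g.
Proof.
have [I0 ID IM] := II.
have V0 : V 0 by split=> //; apply: rpred0.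
move=> le_k hg; elim: k le_k => [|k IH] lt_k //.
have hg' : g \is ((t - k) * d + k * d).-homog.
  by rewrite -mulnDl subnK // ltnW.
apply: (dhomog_pow_mem V0 genV _ (IH (ltnW lt_k)) hg') => [v []//||].
  exact: ideal_pow_closed.
move=> c v hc Vv; apply: (ideal_closed_polar (V := V)) => //.
- exact: ideal_pow_closed.
- move=> x u w [Iu hu] [Iw hw]; split; last by rewrite rpredD ?rpredZ.
  by apply: ID => //; rewrite -mul_mpolyC; apply: IM.
by move=> w Vw; apply: stepV.
Qed.

Lemma ideal_pow_eq g : ideal_pow I t g <->
  ideal_pow (@irrelevant_ideal K n) (t * d) g.
Proof.
rewrite irrelevant_powP; split; last first.
  apply: mindeg_ind; first exact: ideal_pow_closed.
  by move=> m dm; apply: dhomog_ideal_pow => //; rewrite dhomogX; apply/eqP.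
apply: mindeg_pow => f /genV; apply: ideal_gen_min; first exact: mindeg_closed.
by move=> v [_ hv]; apply: mindeg_homog.
Qed.

End PowersOfTheIdeal.

(** * From stalks to torsion *)

Section HomogeneousPrimes.
Variables (K : fieldType) (n : nat).
Local Notation S := {mpoly K[n.+1]}.
Implicit Types (A Q : S -> Prop) (f g : S).

(** An ideal maximal among those containing [A] and no power of [x] is prime: enlarging it by f or
    by g brings in powers of [x], whose product would lie in [Q] if [f * g] did. *)
Lemma maximal_avoiding A (x : S) : ideal_closed A -> (forall k, ~ A (x ^+ k)) ->
  exists Q, [/\ ideal_closed Q, forall f, A f -> Q f, forall k, ~ Q (x ^+ k) &
    forall f g, Q (f * g) -> Q f \/ Q g].
Proof.
move=> AI Ax; pose good Q :=
  [/\ ideal_closed Q, forall f, A f -> Q f & forall k, ~ Q (x ^+ k)].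
have [|Q [gQ maxQ]] :=
    @classical_sets.Zorn_bigcup S (fun Q => (forall f, ~ Q f) \/ good Q).
  move=> F FP totF.
  have [none|[X [FX [f Xf]]]] :
      (forall X, F X -> forall f, ~ X f) \/ (exists X, F X /\ exists f, X f).
    have [[X [FX Xf]]|no] := boolp.EM (exists X, F X /\ exists f, X f).
      by right; exists X.
    by left=> X FX f Xf; apply: no; exists X; split=> //; exists f.
    by left=> f [X FX Xf]; apply: none FX _ Xf.
  have goodX Y g : F Y -> Y g -> good Y by move=> FY Yg; case: (FP _ FY) => // /(_ g).
  right; have [[X0 XD XM] AX XX] := goodX _ _ FX Xf; split.
  - split; first by exists X.
      move=> a c [Y FY Ya] [Z FZ Zc]; have [YZ|ZY] := totF _ _ FY FZ.
        exists Z => //; have [[_ ZD _] _ _] := goodX _ _ FZ Zc.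
        by apply: ZD => //; apply: YZ.
      exists Y => //; have [[_ YD _] _ _] := goodX _ _ FY Ya.
      by apply: YD => //; apply: ZY.
    move=> a c [Y FY Yc]; exists Y => //.
    by have [[_ _ YM] _ _] := goodX _ _ FY Yc; apply: YM.
  - by move=> g Ag; exists X => //; apply: AX.
  - by move=> k [Y FY Yx]; have [_ _] := goodX _ _ FY Yx; apply; apply: Yx.
have {}gQ : good Q.
  case: gQ => // Q0; have [A0 AD AM] := AI.
  case: (maxQ A); last by right.
  by split=> [f /Q0//|/(_ _ A0)/Q0].
have [[Q0 QD QM] AQ Qx] := gQ; exists Q; split=> // f g Qfg.
have [|Qf] := boolp.EM (Q f); first by left.
have [|Qg] := boolp.EM (Q g); first by right.
have ext h : ~ Q h -> exists k q c, Q q /\ x ^+ k = q + c * h.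
  move=> Qh; apply: boolp.contrapT => no.
  case: (maxQ (fun y => exists q c, Q q /\ y = q + c * h)).
    split=> [y Qy|sub]; first by exists y, 0; rewrite mul0r addr0.
    by apply/Qh/sub; exists 0, 1; rewrite add0r mul1r.
  right; split.
  - split; first by exists 0, 0; rewrite mul0r addr0.
      move=> _ _ [q [c [Qq ->]]] [q' [c' [Qq' ->]]].
      by exists (q + q'), (c + c'); split; [apply: (QD) | rewrite mulrDl addrACA].
    move=> a _ [q [c [Qq ->]]]; exists (a * q), (a * c).
    by split; [apply: (QM) | rewrite mulrDr mulrA].
  - by move=> y Ay; exists y, 0; rewrite mul0r addr0; split=> //; apply: AQ.
  - by move=> k [q [c [Qq e]]]; apply: no; exists k, q, c.
have [k [q [c [Qq ek]]]] := ext _ Qf; have [j [q' [c' [Qq' ej]]]] := ext _ Qg.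
case: (Qx (k + j)%N); rewrite exprD ek ej mulrDl.
apply: (QD); first by rewrite mulrC; apply: (QM).
rewrite mulrDr; apply: (QD); first exact: QM.
by rewrite mulrACA; apply: (QM).
Qed.

Lemma pihomog_mulE d f g k : (msize g <= k)%N ->
  pihomog mdeg d (f * g) =
  \sum_(j < k | (j <= d)%N) pihomog mdeg (d - j) f * pihomog mdeg j g.
Proof.
move=> le_k; rewrite {1}(pihomog_partitionE le_k) mulr_sumr raddf_sum /=.
rewrite [RHS]big_mkcond; apply: eq_bigr => j _; have [le_d|lt_d] := leqP j d.
  by rewrite -(pihomogM _ _ (pihomogP _ _ _)) subnK.
by apply: pihomogM_lt lt_d _; apply: pihomogP.
Qed.

Lemma dhomog_Xn (l : 'I_n.+1) k : ('X_l : S) ^+ k \is k.-homog.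
Proof.
rewrite -[X in X.-homog]mul1n; apply: dhomogMn.
by rewrite dhomogX; apply/eqP/mdeg1.
Qed.

(* The homogeneous part of a prime is prime. *)
Lemma proj_point_avoiding A (l : 'I_n.+1) : ideal_closed A ->
  (forall f e, A f -> A (pihomog mdeg e f)) -> (forall k, ~ A ('X_l ^+ k)) ->
  exists P, proj_point P /\ forall f, A f -> P f.
Proof.
move=> AI Ahom /(maximal_avoiding AI)[Q [QI AQ Qx Qprime]].
have [Q0 QD QM] := QI.
(* The largest homogeneous ideal inside [Q]; 1 and X_l stay outside because they are forms outside
   [Q]. *)
pose P f := forall e, Q (pihomog mdeg e f).
have PI : ideal_closed P.
  split; first by move=> e; rewrite pihomog0.
    by move=> f g Pf Pg e; rewrite pihomogD; apply: (QD).
  move=> c f Pf e; rewrite (pihomog_mulE _ _ (leqnn _)).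
  by apply: ideal_closed_sum => // j _; apply: (QM).
exists P; split; last by move=> f Af e; apply/AQ/Ahom.
split.
- by move=> g; apply: ideal_gen_min.
- move=> /(_ 0%N); rewrite pihomog_dE; last exact: dhomog1.
  exact: (Qx 0%N).
- move=> f g Pfg; apply: boolp.contrapT => no.
  (* For the lowest components of [f] and [g] outside [Q], in degrees a and b, every other product
     of components in degree a + b has a factor in [Q]. *)
  have least h : ~ P h ->
      exists a, ~ Q (pihomog mdeg a h) /\ forall c, (c < a)%N -> Q (pihomog mdeg c h).
    move=> Ph; have ex : exists a, boolp.asbool (~ Q (pihomog mdeg a h)).
      apply: boolp.contrapT => no'; apply: Ph => e; apply: boolp.contrapT => Qe.
      by apply: no'; exists e; apply/boolp.asboolP.
    case: (ex_minnP ex) => a /boolp.asboolP Qa min_a; exists a; split=> // c lt_c.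
    apply: boolp.contrapT => Qc; have := min_a c.
    by rewrite leqNgt lt_c => /(_ _)/notF; apply; apply/boolp.asboolP.
  have [a [Qa min_a]] : exists a, ~ Q (pihomog mdeg a f) /\
      forall c, (c < a)%N -> Q (pihomog mdeg c f).
    by apply: least => Pf; apply: no; left.
  have [b [Qb min_b]] : exists b, ~ Q (pihomog mdeg b g) /\
      forall c, (c < b)%N -> Q (pihomog mdeg c g).
    by apply: least => Pg; apply: no; right.
  suff : Q (pihomog mdeg a f * pihomog mdeg b g) by case/Qprime.
  have := Pfg (a + b)%N.
  have le_k : (msize g <= maxn (msize g) b.+1)%N by rewrite leq_maxl.
  have lt_b : (b < maxn (msize g) b.+1)%N by rewrite leq_maxr.
  rewrite (pihomog_mulE _ _ le_k) (bigD1 (Ordinal lt_b)) /= ?leq_addl // addnK.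
  set s := \sum_(j < _ | _) _ => Qs; have Qs' : Q s.
    apply: ideal_closed_sum => // j /andP[le_j ne]; have [lt_jb|le_bj] := ltnP j b.
      by apply: (QM); apply: min_b.
    rewrite mulrC; apply: (QM); apply: min_a.
    have : j != b :> nat by apply: contraNneq ne => e; apply/eqP/val_inj.
    lia.
  have -> : pihomog mdeg a f * pihomog mdeg b g =
    pihomog mdeg a f * pihomog mdeg b g + s + (-1) * s by rewrite mulN1r addrK.
  by apply: (QD) => //; apply: (QM).
- move=> f e Pf e'; have [->|ne] := eqVneq e e'; first by rewrite pihomog_id.
  by rewrite (pihomog_ne0 ne) // pihomogP.
- exists l => /(_ 1%N); rewrite pihomog_dE; first exact: (Qx 1%N).
  exact: (dhomog_Xn l 1).
Qed.

Lemma proj_point_Xn (P : S -> Prop) (l : 'I_n.+1) k :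
  proj_point P -> ~ P 'X_l -> ~ P ('X_l ^+ k).
Proof.
move=> [_ P1 Pprime _ _] Pl; elim: k => [|k IH]; first by rewrite expr0.
by rewrite exprS => /Pprime[].
Qed.

Lemma proj_point_prod (P : S -> Prop) m (b : 'I_m -> S) :
  proj_point P -> (forall k, ~ P (b k)) -> ~ P (\prod_k b k).
Proof.
move=> [_ P1 Pprime _ _] Pb; elim/big_ind: _ => // f g Pf Pg; by case/Pprime.
Qed.

Lemma proj_point_nz (P : S -> Prop) f : proj_point P -> ~ P f -> f != 0.
Proof.
move=> [PI _ _ _ _] Pf; apply/eqP => f0; apply: Pf; rewrite f0.
by apply: PI; case: (ideal_gen_closed P).
Qed.

Lemma m_primary_Xn (I : S -> Prop) (l : 'I_n.+1) :
  m_primary I -> exists k, I ('X_l ^+ k).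
Proof.
(* The successor keeps the exponent positive: X_l^0 = 1 is not in the irrelevant ideal. *)
case=> k Ik; exists k.+1; apply/(Ik k.+1 (leqnSn _)); first exact: dhomog_Xn.
have [_ _ mM] := @ideal_gen_closed K n (fun g => exists i, g = 'X_i).
by rewrite exprSr; apply: mM; apply: ideal_gen_mem; exists l.
Qed.

End HomogeneousPrimes.

(** * Annihilators of homology classes *)

Section LocalToTorsion.
Variables (K : fieldType) (n r : nat) (hd tw : 'I_r -> nat).
Local Notation S := {mpoly K[n.+1]}.
Variable (D : 'M[S]_r).
Hypotheses (dD : mxdeg hd hd 0 1 D) (hD : mx_homog tw tw D).

Lemma bipartZ j e e' (v : 'rV[S]_r) c : mx_homog (fun=> e) tw v ->
  mxdeg (fun=> j) hd 0 0 v ->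
  bipart hd tw j (e' + e) (c *: v) = pihomog mdeg e' c *: v.
Proof.
move=> hv dv; apply/rowP => b; rewrite !mxE.
have [->|nz] := eqVneq (v 0 b) 0; first by rewrite !mulr0 raddf0 if_same.
have tb := hv 0 b _ (mlead_supp nz).
have := dv _ _ nz; rewrite !addn0 => <-; rewrite eqxx /=.
have -> : (tw b <= e' + e)%N by lia.
have hb : v 0 b \is (e - tw b).-homog by apply/dhomogP => m /hv <-; rewrite addnK.
by rewrite -(pihomogM _ _ hb); congr pihomog; lia.
Qed.

(** The scalars carrying [v] into the image of [D] form an ideal, homogeneous because [v] is
    bihomogeneous. If it missed all powers of X_l, some point of Proj S would contain it, against
    local exactness there. *)
Lemma torsion_of_local_homog j e (v : 'rV[S]_r) :
  mxdeg (fun=> j) hd 0 0 v -> mx_homog (fun=> e) tw v ->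
  (forall P, proj_point P -> exists2 b, ~ P b & exists w, b *: v = w *m D) ->
  forall l : 'I_n.+1, exists k w, mxdeg (fun=> j.+1) hd 0 0 w /\
    'X_l ^+ k *: v = w *m D.
Proof.
move=> dv hv loc l; pose A b := exists w, b *: v = w *m D.
suff [k [w wE]] : exists k, A ('X_l ^+ k).
  exists k, (bipart hd tw j.+1 (k + e) w); split; first exact: bipart_deg.
  rewrite -bipart_diff // -wE bipartZ // pihomog_dE //.
  exact: dhomog_Xn.
apply: boolp.contrapT => no; have [||k Ak|P [PP AP]] := @proj_point_avoiding _ _ A l.
- split; first by exists 0; rewrite scale0r mul0mx.
    by move=> a b [w wE] [w' wE']; exists (w + w'); rewrite scalerDl mulmxDl wE wE'.
  by move=> c a [w wE]; exists (c *: w); rewrite -scalemxAl -wE scalerA.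
- move=> f e' [w wE]; exists (bipart hd tw j.+1 (e' + e) w).
  by rewrite -bipart_diff // -wE bipartZ.
- by apply: no; exists k.
by have [b Pb /AP] := loc P PP.
Qed.

Lemma bipart_partition j (v : 'rV[S]_r) : mxdeg (fun=> j) hd 0 0 v ->
  exists E, v = \sum_(e < E) bipart hd tw j e v.
Proof.
move=> dv; exists (\sum_b (tw b + msize (v 0%R b)))%N; apply/rowP => b.
apply/mpolyP => m; rewrite summxE raddf_sum /=.
have coef e : (bipart hd tw j e v 0 b)@_m =
    if (tw b + mdeg m == e)%N then (v 0 b)@_m else 0.
  rewrite mxE; have [->|nz] := eqVneq (v 0 b) 0.
    by rewrite raddf0 !if_same mcoeff0 if_same.
  have := dv _ _ nz; rewrite !addn0 => ->; rewrite eqxx /=.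
  case: ifPn => [le_e|gt_e]; last by rewrite mcoeff0 ifN //; lia.
  by rewrite pihomog_sel mcoeff_sel; congr (if _ then _ else _); lia.
have [m_v|m_v] := boolP (m \in msupp (v 0 b)); last first.
  by rewrite (memN_msupp_eq0 m_v) big1 // => e _; rewrite coef memN_msupp_eq0 ?if_same.
have lt_m : (tw b + mdeg m < \sum_b (tw b + msize (v 0%R b)))%N.
  by rewrite (bigD1 b) //=; have := msize_mdeg_lt m_v; lia.
rewrite (bigD1 (Ordinal lt_m)) //= coef eqxx big1 ?addr0 // => e ne.
by rewrite coef ifN //; apply: contraNneq ne => e_m; apply/eqP/val_inj.
Qed.

Lemma torsion_of_local j :
  (forall e (v : 'rV[S]_r) P, mxdeg (fun=> j) hd 0 0 v ->
    mx_homog (fun=> e) tw v -> v *m D = 0 -> proj_point P ->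
    exists2 b, ~ P b & exists w, b *: v = w *m D) ->
  forall (v : 'rV[S]_r) (l : 'I_n.+1), mxdeg (fun=> j) hd 0 0 v -> v *m D = 0 ->
  exists k w, mxdeg (fun=> j.+1) hd 0 0 w /\ 'X_l ^+ k *: v = w *m D.
Proof.
move=> loc v l dv vD; have [E vE] := bipart_partition dv.
have /fin_all_exists[k /fin_all_exists[w wP]] : forall e : 'I_E, exists k w,
    mxdeg (fun=> j.+1) hd 0 0 w /\ 'X_l ^+ k *: bipart hd tw j e v = w *m D.
  move=> e; have de := @bipart_deg _ _ _ hd tw j e v.
  have he := @bipart_homog _ _ _ hd tw j e v.
  apply: (torsion_of_local_homog (de) (he) _ l) => P PP; apply: (loc _ _ _ (de) (he)) PP.
  (* [bipart_diff] covers positive degrees; on degree 0 the differential vanishes for degree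
     reasons. *)
  case: j {loc} dv de he vE => [|j] dv de he _; last first.
    rewrite -bipart_diff // vD; apply/rowP => b.
    by rewrite !mxE raddf0 if_same.
  apply/rowP => b; rewrite [RHS]mxE; apply/eqP; apply: contraT => nz.
  by have := mxdegM de dD nz; lia.
exists (\sum_e k e)%N, (\sum_e 'X_l ^+ (\sum_e k e - k e) *: w e); split.
  apply: (big_ind (fun w : 'rV[S]_r => mxdeg (fun=> j.+1) hd 0 0 w)).
  - by move=> a b; rewrite mxE eqxx.
  - exact: mxdegD.
  - by move=> e _; apply: mxdegZ; case: (wP e).
rewrite {1}vE scaler_sumr mulmx_suml; apply: eq_bigr => e _.
rewrite -scalemxAl; have [_ <-] := wP e; rewrite scalerA -exprD subnK //.
by rewrite (bigD1 e) //= leq_addr.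
Qed.

End LocalToTorsion.

(** * The truncated linear strand *)

Section Strand.
Variables (K : fieldType) (n d p : nat) (F : graded_free_complex K n).
Local Notation S := {mpoly K[n.+1]}.
Local Notation rk := (gfc_rank F).
Local Notation diff := (gfc_diff F).
Local Notation aug := (gfc_aug F).

Definition strand_elt i (k : 'I_(rk i)) : bool := gfc_twist k == (d + i)%N.

Definition strand_width : nat := \max_(i < p.+1) rk i.
Local Notation W := strand_width.
(** All terms are padded to a common width to get a product index set; the successor leaves room for
    S even if all ranks vanish. *)
Definition strand_dim : nat := (p.+2 * W.+1)%N.
Local Notation r := strand_dim.

(* Index (0, 0) carries S and index (i + 1, k) the k-th generator of F_i. *)
Definition strand_idx (i k : nat) : 'I_r :=
  mxtens_index (inord i : 'I_p.+2, inord k : 'I_W.+1).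

(** Rows of generators outside the strand are zero, so the transpose goes back and [J i *m (J i)^T]
    is the projection [Pi i] onto the strand. *)
Definition strand_emb i : 'M[S]_(rk i, r) :=
  \matrix_(k, b) (strand_elt k && (b == strand_idx i.+1 k))%:R.
Local Notation J := strand_emb.

Definition strand_unit : 'rV[S]_r := \row_b (b == strand_idx 0 0)%:R.
Local Notation o := strand_unit.

Definition strand_proj i : 'M[S]_(rk i) := diag_mx (\row_k (strand_elt k)%:R).
Local Notation Pi := strand_proj.

(* The indices that carry no generator of the truncated strand are given the
   unused degree [p + 2]. *)
Definition strand_hd (b : 'I_r) : nat :=
  let c := mxtens_unindex b in
  if nat_of_ord c.1 is i.+1 then
    if [exists k : 'I_(rk i), strand_elt k && (c.2 == k :> nat)] then i.+1 else p.+2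
  else if c.2 == 0%N :> nat then 0%N else p.+2.
Local Notation hd := strand_hd.

(** Padding indices, of degree p + 2, receive twist d + p + 1 and so obey the same bound as true
    generators. *)
Definition strand_tw (b : 'I_r) : nat := if hd b is h.+1 then (d + h)%N else 0%N.
Local Notation tw := strand_tw.

Definition strand_diff : 'M[S]_r :=
  \sum_(i < p) (J i.+1)^T *m diff i *m J i + (J 0)^T *m aug *m o.
Local Notation D := strand_diff.

Lemma rank_le_width i : (i <= p)%N -> (rk i <= W)%N.
Proof. by move=> le_i; apply: (leq_bigmax (Ordinal (le_i : (i < p.+1)%N))). Qed.

Lemma strand_unindex i k : (i <= p.+1)%N -> (k <= W)%N ->
  (nat_of_ord (mxtens_unindex (strand_idx i k)).1 = i) *
  (nat_of_ord (mxtens_unindex (strand_idx i k)).2 = k).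
Proof. by move=> le_i le_k; rewrite mxtens_indexK /= !inordK. Qed.

Lemma strand_idx_eq i k i' k' : (i <= p.+1)%N -> (k <= W)%N ->
  (i' <= p.+1)%N -> (k' <= W)%N ->
  (strand_idx i k == strand_idx i' k') = (i == i') && (k == k').
Proof.
move=> le_i le_k le_i' le_k'; apply/eqP/andP => [e|[/eqP-> /eqP->]] //.
have [e1 e2] := strand_unindex le_i le_k; rewrite e in e1 e2.
by rewrite -e1 -e2 !strand_unindex.
Qed.

Lemma ord_le_width i (k : 'I_(rk i)) : (i <= p)%N -> (k <= W)%N.
Proof. by move=> /rank_le_width; apply/leq_trans/ltnW. Qed.

Lemma strand_emb_mul i i' (k : 'I_(rk i)) (k' : 'I_(rk i')) :
  (i <= p)%N -> (i' <= p)%N ->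
  (J i *m (J i')^T) k k' =
  [&& strand_elt k, strand_elt k', i == i' & k == k' :> nat]%:R.
Proof.
move=> le_i le_i'; rewrite mxE (bigD1 (strand_idx i.+1 k)) //= !mxE eqxx andbT.
rewrite strand_idx_eq ?eqSS ?ord_le_width // big1 ?addr0.
  by rewrite -natrM mulnb.
by move=> b ne; rewrite !mxE (negbTE ne) andbF mul0r.
Qed.

Lemma strand_embK i : (i <= p)%N -> J i *m (J i)^T = Pi i.
Proof.
move=> le_i; apply/matrixP => k k'; rewrite strand_emb_mul // eqxx !mxE /=.
rewrite -(inj_eq val_inj) /=.
case: eqP => [/val_inj ->|_]; rewrite ?andbF ?mulr0n //.
by rewrite andbT andbb mulr1n.
Qed.

Lemma strand_emb_ortho i i' : (i <= p)%N -> (i' <= p)%N -> i != i' ->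
  J i *m (J i')^T = 0.
Proof.
move=> le_i le_i' ne; apply/matrixP => k k'.
by rewrite strand_emb_mul // (negbTE ne) !andbF mxE.
Qed.

Lemma strand_unitK : o *m o^T = 1%:M.
Proof.
apply/rowP => j; rewrite [j]ord1 mxE (bigD1 (strand_idx 0 0)) //= !mxE eqxx mulr1.
by rewrite big1 ?addr0 // => b ne; rewrite !mxE (negbTE ne) mul0r.
Qed.

Lemma strand_unit_ortho i : (i <= p)%N -> o *m (J i)^T = 0.
Proof.
move=> le_i; apply/rowP => k; rewrite !mxE big1 // => b _; rewrite !mxE.
have [->|_] := eqVneq b (strand_idx 0 0); last by rewrite mul0r.
by rewrite strand_idx_eq ?ord_le_width //= andbF mulr0.
Qed.

Lemma strand_hd_idx i (k : 'I_(rk i)) : (i <= p)%N -> strand_elt k ->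
  hd (strand_idx i.+1 k) = i.+1.
Proof.
move=> le_i sk; have [e1 e2] := @strand_unindex i.+1 k le_i (ord_le_width k le_i).
rewrite /strand_hd e1 e2; case: ifP => // /negbT/existsPn/(_ k).
by rewrite sk eqxx.
Qed.

Lemma strand_hd0 : hd (strand_idx 0 0) = 0%N.
Proof.
have [e1 e2] := @strand_unindex 0 0 (leq0n _) (leq0n _).
by rewrite /strand_hd e1 e2 eqxx.
Qed.

Lemma strand_hd_inv i b : (i <= p)%N -> hd b = i.+1 ->
  exists2 k : 'I_(rk i), strand_elt k & b = strand_idx i.+1 k.
Proof.
move=> le_i; case: (mxtens_indexP b) => b1 b2; rewrite /strand_hd mxtens_indexK /=.
case e: (nat_of_ord b1) => [|j]; first by case: ifP => // _; lia.
case: ifP => [/existsP[k /andP[sk /eqP ek]] [ej]|_]; last by lia.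
rewrite ej in k sk ek e; exists k => //.
by congr mxtens_index; congr pair; apply: val_inj; rewrite /= inordK -?e -?ek.
Qed.

Lemma strand_hd_inv0 b : hd b = 0%N -> b = strand_idx 0 0.
Proof.
case: (mxtens_indexP b) => b1 b2; rewrite /strand_hd mxtens_indexK /=.
case e: (nat_of_ord b1) => [|j]; last by case: ifP.
case: ifP => // /eqP e2 _.
by congr mxtens_index; congr pair; apply: val_inj; rewrite /= inordK ?e.
Qed.

Lemma strand_emb_deg i : (i <= p)%N -> mxdeg (fun=> i.+1) hd 0 0 (J i).
Proof.
move=> le_i k b; rewrite mxE; case: andP => [[sk /eqP ->] _|_].
  by rewrite strand_hd_idx.
by rewrite eqxx.
Qed.

Lemma strand_unit_deg : mxdeg (fun=> 0%N) hd 0 0 o.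
Proof.
move=> k b; rewrite mxE; have [->|_] := eqVneq b (strand_idx 0 0).
  by rewrite strand_hd0.
by rewrite eqxx.
Qed.

Lemma mxdeg_tr m1 m2 (f : 'I_m1 -> nat) (g : 'I_m2 -> nat) (A : 'M[S]_(m1, m2)) :
  mxdeg f g 0 0 A -> mxdeg g f 0 0 A^T.
Proof. by move=> dA i j; rewrite mxE => /dA. Qed.

Lemma strand_diff_deg : mxdeg hd hd 0 1 D.
Proof.
have cst i m m' (A : 'M[S]_(m, m')) : mxdeg (fun=> i.+1) (fun=> i) 0 1 A.
  by move=> k l _; rewrite addn0 addn1.
apply: mxdegD.
  apply: (big_ind (fun A : 'M[S]_r => mxdeg hd hd 0 1 A)).
  - by move=> a b; rewrite mxE eqxx.
  - exact: mxdegD.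
  - move=> i _; have [Ji Ji1] := (strand_emb_deg (ltnW (ltn_ord i)), strand_emb_deg (ltn_ord i)).
    exact: (mxdegM (mxdegM (mxdeg_tr Ji1) (cst _ _ _ _)) Ji).
have J0 := mxdeg_tr (strand_emb_deg (leq0n p)).
exact: (mxdegM (mxdegM J0 (cst _ _ _ _)) strand_unit_deg).
Qed.

Lemma strand_emb_diff i : (i < p)%N -> J i.+1 *m D = Pi i.+1 *m diff i *m J i.
Proof.
move=> lt_i; rewrite mulmxDr mulmx_sumr (bigD1 (Ordinal lt_i)) //= !mulmxA.
rewrite strand_embK // strand_emb_ortho // !mul0mx addr0 big1 ?addr0 // => j ne.
rewrite !mulmxA strand_emb_ortho ?mul0mx //.
by rewrite eqSS; apply: contraNneq ne => e; apply/eqP/val_inj.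
Qed.

Lemma strand_emb_aug : J 0 *m D = Pi 0 *m aug *m o.
Proof.
rewrite mulmxDr mulmx_sumr !mulmxA strand_embK // big1 ?add0r // => j _.
by rewrite !mulmxA strand_emb_ortho ?mul0mx.
Qed.

Lemma strand_unit_diff : o *m D = 0.
Proof.
rewrite mulmxDr mulmx_sumr !mulmxA strand_unit_ortho // !mul0mx addr0 big1 // => j _.
by rewrite !mulmxA strand_unit_ortho ?mul0mx.
Qed.

Lemma strand_diff_unit : D *m o^T = (J 0)^T *m aug.
Proof.
have Jo i : (i <= p)%N -> J i *m o^T = 0.
  by move=> le_i; rewrite -[J i]trmxK -trmx_mul strand_unit_ortho // trmx0.
rewrite mulmxDl mulmx_suml -[_ *m o *m _]mulmxA strand_unitK mulmx1.
by rewrite big1 ?add0r // => j _; rewrite -mulmxA Jo ?mulmx0 // ltnW.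
Qed.

Lemma strand_embK_deg i (v : 'rV[S]_r) : (i <= p)%N ->
  mxdeg (fun=> i.+1) hd 0 0 v -> v *m (J i)^T *m J i = v.
Proof.
move=> le_i dv; apply/rowP => b; rewrite mxE.
have [v0|nz] := eqVneq (v 0 b) 0.
  rewrite v0 big1 // => k _; rewrite !mxE.
  case: andP => [[sk /eqP eb]|_]; last by rewrite mulr0.
  rewrite mulr1 big1 // => c _; rewrite !mxE.
  case: andP => [[_ /eqP ec]|_]; last by rewrite mulr0.
  by rewrite ec -eb v0 mul0r.
have := dv _ _ nz; rewrite !addn0 => /esym/(strand_hd_inv le_i)[k sk eb].
rewrite (bigD1 k) //= big1 ?addr0 => [|k' ne].
  rewrite !mxE sk eb eqxx mulr1 (bigD1 b) //= -eb !mxE sk eb eqxx mulr1.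
  by rewrite big1 ?addr0 // => c ne; rewrite !mxE (negbTE ne) andbF mulr0.
rewrite [J i k' b]mxE eb strand_idx_eq ?ord_le_width // eqxx /=.
by rewrite (_ : _ == _ = false) ?andbF ?mulr0 //; apply/negbTE; rewrite eq_sym.
Qed.

Lemma strand_unitK_deg (v : 'rV[S]_r) : mxdeg (fun=> 0%N) hd 0 0 v ->
  v = v 0 (strand_idx 0 0) *: o.
Proof.
move=> dv; apply/rowP => b; rewrite !mxE.
have [->|ne] := eqVneq b (strand_idx 0 0); first by rewrite mulr1.
rewrite mulr0; apply/eqP; apply: contraNT ne => /dv.
by rewrite !addn0 => /esym/strand_hd_inv0 ->.
Qed.

Lemma strand_proj_tr_emb i : (J i)^T *m Pi i = (J i)^T.
Proof.
apply/matrixP => b k; rewrite mul_mx_diag !mxE.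
by case: (strand_elt k); rewrite ?mulr1 ?mulr0.
Qed.

End Strand.

Section MxHomogProduct.
Variables (N : nat) (K : comNzRingType).
Local Notation S := {mpoly K[N]}.

Lemma mx_homogM m n q (f : 'I_m -> nat) (g : 'I_n -> nat) (h : 'I_q -> nat)
    (A : 'M[S]_(m, n)) (B : 'M[S]_(n, q)) :
  mx_homog f g A -> mx_homog g h B -> mx_homog f h (A *m B).
Proof.
move=> hA hB i j mo; rewrite mxE => /msupp_sum_le/flatten_mapP[k _].
move=> /mem_msuppM[m1 [m2 [/hA e1 /hB e2 ->]]].
by rewrite mdegD -addnA e2 e1.
Qed.

Lemma mx_homog_tr m n (f : 'I_m -> nat) (g : 'I_n -> nat) (A : 'M[S]_(m, n)) :
  (forall i j, exists c : K, A i j = c%:MP) ->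
  mx_homog f g A -> mx_homog g f A^T.
Proof.
move=> AC hA i j mo; rewrite mxE; have [c Ac] := AC j i.
have := hA j i mo; rewrite Ac msuppC; case: eqP => // _ e; rewrite inE => /eqP m0.
by rewrite m0 mdeg0 !add0n in e *; rewrite e // inE.
Qed.

End MxHomogProduct.

(** * The linear strand of a minimal resolution *)

Section StrandOfResolution.
Variables (K : fieldType) (n d p : nat) (F : graded_free_complex K n).
Variable I : {mpoly K[n.+1]} -> Prop.
Local Notation S := {mpoly K[n.+1]}.
Local Notation rk := (gfc_rank F).
Local Notation diff := (gfc_diff F).
Local Notation aug := (gfc_aug F).
Local Notation twist i := (@gfc_twist K n F i).
Local Notation V := (fun v => I v /\ v \is d.-homog).
Local Notation J := (strand_emb d p F).
Local Notation Pi := (@strand_proj K n d F).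
Local Notation o := (strand_unit p F).
Local Notation D := (strand_diff d p F).
Local Notation hd := (@strand_hd K n d p F).
Local Notation tw := (@strand_tw K n d p F).
Hypotheses (II : ideal_closed I) (genV : forall f, I f -> ideal_gen V f).
Hypotheses (Fres : is_free_resolution F I) (Fmin : is_minimal F).

Lemma ideal_mindeg f : I f -> mindeg d f.
Proof.
move/genV; apply: ideal_gen_min; first exact: mindeg_closed.
by move=> v [_ /mindeg_homog].
Qed.

Lemma diff_homog i : mx_homog (twist i.+1) (twist i) (diff i).
Proof.
move=> j k m; have := @gfc_diff_homog _ _ F i j k.
case: leqP => [le_t /dhomogP hA /hA e|_ /eqP ->]; last by rewrite msupp0.
by rewrite [mdeg m]e subnK.
Qed.

Lemma diff_min i j k m : m \in msupp (diff i j k) -> (0 < mdeg m)%N.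
Proof.
suff /(_ m) : mindeg 1 (diff i j k) by [].
apply: (@ideal_gen_min K n _ (mindeg 1)) (Fmin j k); first exact: mindeg_closed.
by move=> _ [l ->] m'; rewrite msuppX inE => /eqP ->; rewrite mdeg1.
Qed.

Lemma diff_twist i j k : diff i j k != 0 -> (twist i k < twist i.+1 j)%N.
Proof.
move=> nz; have := diff_homog (mlead_supp nz); have := diff_min (mlead_supp nz).
lia.
Qed.

(** By minimality a boundary has all its coordinates in the irrelevant ideal, which does not contain
    1. *)
Lemma delta_not_boundary i j w : delta_mx 0 j <> w *m diff i :> 'rV_(rk i).
Proof.
move=> /rowP/(_ j); rewrite !mxE !eqxx /= => e1.
have : mindeg 1 (1 : S).
  have -> : (1 : S) = \sum_k w 0 k * diff i k j by exact: e1.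
  apply: ideal_closed_sum; first exact: mindeg_closed.
  move=> k _; have [_ _ M1] := @mindeg_closed K n 1.
  by apply: M1 => m; apply: diff_min.
by move=> /(_ 0%MM); rewrite msupp1 mem_head mdeg0 => /(_ isT).
Qed.

Lemma aug_ideal k : I (aug k 0).
Proof.
have [FI _ _] := Fres; apply/FI; exists (delta_mx 0 k); rewrite -rowE.
by apply/rowP => j; rewrite [j]ord1 !mxE eqxx mulr1n.
Qed.

(** A generator killed by the differential would be a boundary, which minimality excludes. So it has
    a nonzero entry towards the previous term, of positive degree, and the twist grows at each
    step. *)
Lemma twist_ge i k : (d + i <= twist i k)%N.
Proof.
have [_ ker0 kerS] := Fres; elim: i k => [|i IH] k.
  have nz : aug k 0 != 0.
    apply/eqP => a0; have [] := ker0 (delta_mx 0 k).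
    case=> [|w /delta_not_boundary//].
    by rewrite -rowE; apply/rowP => j; rewrite [j]ord1 !mxE a0.
  have := ideal_mindeg (aug_ideal k) (mlead_supp nz).
  have /dhomogP/(_ _ (mlead_supp nz)) := @gfc_aug_homog _ _ F k.
  by move=> e; rewrite addn0 -[twist 0 k]e.
have [/existsP[l nz]|/existsPn z] := boolP [exists l, diff i k l != 0].
  by have := diff_twist nz; have := IH l; lia.
have [] := kerS i (delta_mx 0 k); case=> [|w /delta_not_boundary//].
by rewrite -rowE; apply/rowP => l; have := z l; rewrite negbK !mxE => /eqP.
Qed.

(** The strand is a subcomplex: a generator of twist d + i + 1 reaches only smaller twists, and
    [twist_ge] leaves d + i alone. *)
Lemma strand_proj_diff i : Pi i.+1 *m diff i *m Pi i = Pi i.+1 *m diff i.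
Proof.
rewrite /strand_proj mul_mx_diag mul_diag_mx; apply/matrixP => j k; rewrite !mxE.
case sj: (strand_elt d j); last by rewrite !mul0r.
have [->|/diff_twist lt_t] := eqVneq (diff i j k) 0; first by rewrite !(mulr0, mul0r).
suff -> : strand_elt d k by rewrite mulr1.
by rewrite /strand_elt; have := twist_ge k; move/eqP: sj; lia.
Qed.

Lemma diff_sq i : diff i.+1 *m diff i = 0.
Proof.
have [_ _ kerS] := Fres; apply/row_matrixP => j; rewrite row0 row_mul.
by apply/kerS; exists (delta_mx 0 j); rewrite -rowE.
Qed.

Lemma diff_aug : diff 0 *m aug = 0.
Proof.
have [_ ker0 _] := Fres; apply/row_matrixP => j; rewrite row0 row_mul.
by apply/ker0; exists (delta_mx 0 j); rewrite -rowE.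
Qed.

Lemma strand_diff_sq : D *m D = 0.
Proof.
rewrite {1}/strand_diff mulmxDl -[_ *m o *m D]mulmxA strand_unit_diff mulmx0 addr0.
rewrite mulmx_suml big1 // => -[[|i] lt_i] _ /=.
  rewrite -mulmxA strand_emb_aug -(@strand_proj_tr_emb K n d p F 1) -!mulmxA.
  rewrite [Pi 1 *m (_ *m _)]mulmxA [Pi 1 *m diff 0 *m (Pi 0 *m _)]mulmxA.
  rewrite strand_proj_diff -[Pi 1 *m diff 0 *m _]mulmxA [diff 0 *m (aug *m _)]mulmxA.
  by rewrite diff_aug mul0mx !mulmx0.
rewrite -mulmxA strand_emb_diff 1?ltnW // -(@strand_proj_tr_emb K n d p F i.+2) -!mulmxA.
rewrite [Pi i.+2 *m (_ *m _)]mulmxA [Pi i.+2 *m diff i.+1 *m (Pi i.+1 *m _)]mulmxA.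
rewrite strand_proj_diff -[Pi i.+2 *m diff i.+1 *m _]mulmxA.
rewrite [diff i.+1 *m (diff i *m _)]mulmxA.
by rewrite diff_sq mul0mx !mulmx0.
Qed.

Lemma strand_emb_const i k b : exists c : K, J i k b = c%:MP.
Proof.
exists (strand_elt d k && (b == strand_idx p F i.+1 k))%:R.
by rewrite mxE rmorph_nat.
Qed.

Lemma strand_emb_homog i : (i <= p)%N -> mx_homog (twist i) tw (J i).
Proof.
move=> le_i; apply: (@mx_homog_const _ _ _ _ _ _ _
  (fun k b => (strand_elt d k && (b == strand_idx p F i.+1 k))%:R)).
  by move=> k b; rewrite mxE rmorph_nat.
move=> k b; case: andP => [[sk /eqP ->] _|_]; last by rewrite eqxx.
by rewrite /strand_tw strand_hd_idx //; apply/eqP.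
Qed.

Lemma strand_unit_homog : mx_homog (fun=> 0%N) tw o.
Proof.
apply: (@mx_homog_const _ _ _ _ _ _ _ (fun k b => (b == strand_idx p F 0 0)%:R)).
  by move=> k b; rewrite mxE rmorph_nat.
move=> k b; have [-> _|_] := eqVneq b _; last by rewrite eqxx.
by rewrite /strand_tw strand_hd0.
Qed.

Lemma aug_homog : mx_homog (twist 0) (fun=> 0%N) aug.
Proof.
by move=> k j m; rewrite [j]ord1 addn0; apply/dhomogP/gfc_aug_homog.
Qed.

Lemma strand_diff_homog : mx_homog tw tw D.
Proof.
have JT i : (i <= p)%N -> mx_homog tw (twist i) (J i)^T.
  by move=> le_i; apply: mx_homog_tr (strand_emb_homog le_i) => *; apply: strand_emb_const.
apply: mx_homogD.
  apply: (big_ind (fun A : 'M[S]_(strand_dim p F) => mx_homog tw tw A)).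
  - by move=> a b m; rewrite mxE msupp0.
  - exact: mx_homogD.
  - move=> i _; apply: mx_homogM (strand_emb_homog (ltnW (ltn_ord i))).
    by apply: mx_homogM (JT _ (ltn_ord i)) (@diff_homog i).
apply: mx_homogM strand_unit_homog.
by apply: mx_homogM (JT _ (leq0n p)) aug_homog.
Qed.

(** The constant terms of any lift suffice: in degree d, generators of twist d take constant
    coefficients and those of larger twist contribute nothing. *)
Lemma strand_lift v : V v ->
  exists2 y : 'rV_(rk 0), mx_homog (fun=> d) (twist 0) y &
    y *m Pi 0 *m aug = v%:M.
Proof.
have [FI _ _] := Fres; case=> /FI[y0 y0E] hv.
exists (\row_k if strand_elt d k then pihomog mdeg 0 (y0 0 k) else 0).
  move=> i k m; rewrite mxE; case: ifP => [/eqP sk|_]; last by rewrite msupp0.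
  by rewrite pihomog_sel msupp_sel => /andP[/eqP -> _]; rewrite sk addn0.
apply/rowP => j; rewrite [j]ord1 [RHS]mxE eqxx mulr1n -[in RHS](pihomog_dE hv).
have -> : v = \sum_k y0 0 k * aug k 0.
  by have /rowP/(_ 0) := y0E; rewrite !mxE eqxx mulr1n => <-.
rewrite mxE raddf_sum /=; apply: eq_bigr => k _; rewrite mul_mx_diag !mxE.
have ak := @gfc_aug_homog _ _ F k; case sk: (strand_elt d k).
  by rewrite mulr1 -(pihomogM _ _ ak); congr pihomog; move/eqP: sk; lia.
rewrite !mul0r; symmetry; apply: pihomogM_lt ak.
by have := twist_ge k; move/eqP: sk; lia.
Qed.

Lemma strand_lift_ideal f : I f -> exists y : 'rV_(rk 0), y *m Pi 0 *m aug = f%:M.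
Proof.
move/genV; apply: (@ideal_gen_min K n _
  (fun f => exists y : 'rV_(rk 0), y *m Pi 0 *m aug = f%:M)) => [|v /strand_lift[y _ yE]];
  last by exists y.
split; first by exists 0; rewrite !mul0mx; apply/rowP => j; rewrite !mxE mul0rn.
  move=> f1 f2 [y1 e1] [y2 e2]; exists (y1 + y2).
  by rewrite !mulmxDl e1 e2; apply/rowP => j; rewrite !mxE mulrnDl.
move=> c f1 [y1 e1]; exists (c *: y1); rewrite -!scalemxAl e1.
by rewrite scale_scalar_mx.
Qed.
(** The product of the denominators of all coordinates stays outside [P] because [P] is prime. *)
Lemma clear_denominators (P : S -> Prop) i (w : 'rV[{fraction S}]_(rk i)) : proj_point P ->
  strand_stalk d P w -> exists b c, [/\ ~ P b,
    c *m Pi i = c & tofrac b *: w = map_mx (@tofrac S) c].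
Proof.
move=> PP sw.
have /fin_all_exists[b /fin_all_exists[c bc]] : forall k, exists b c,
    [/\ ~ P b, ~~ strand_elt d k -> c = 0 & tofrac b * w 0 k = tofrac c].
  move=> k; have := sw k; rewrite -/(strand_elt d k); case: strand_elt.
    move=> [e [f [g [_ _ _ Pg ->]]]]; exists g, f; split=> //.
    have g0 := proj_point_nz PP Pg.
    by rewrite mulrCA mulfV ?mulr1 // tofrac_eq0.
  move=> ->; exists 1, 0; split=> //; first by case: PP.
  by rewrite mulr0 tofrac0.
exists (\prod_k b k), (\row_k (\prod_(l | l != k) b l * c k)); split.
- by apply: proj_point_prod => // k; case: (bc k).
- rewrite /strand_proj mul_mx_diag; apply/rowP => k; rewrite !mxE.
  by have [_ c0 _] := bc k; case: strand_elt c0 => [|->//]; rewrite ?mulr1 // !(mulr0, mul0r).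
apply/rowP => k; rewrite !mxE (bigD1 k) //= mulrC [b k * _]mulrC !rmorphM /=.
by have [_ _ <-] := bc k; rewrite mulrC mulrA.
Qed.

Lemma strand_kernel_aug (z : 'rV[S]_(rk 0)) :
  z *m Pi 0 = z -> z *m J 0 *m D = 0 -> z *m aug = 0.
Proof.
move=> zPi; rewrite -mulmxA strand_emb_aug !mulmxA zPi.
by move/(congr1 (mulmx^~ o^T)); rewrite mul0mx -mulmxA strand_unitK mulmx1.
Qed.

Lemma strand_kernel_diff i (z : 'rV[S]_(rk i.+1)) : (i < p)%N ->
  z *m Pi i.+1 = z -> z *m J i.+1 *m D = 0 -> z *m diff i = 0.
Proof.
move=> lt_i zPi; rewrite -mulmxA strand_emb_diff // mulmxA.
move/(congr1 (mulmx^~ (J i)^T)); rewrite mul0mx -mulmxA strand_embK 1?ltnW //.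
by rewrite -mulmxA strand_proj_diff mulmxA zPi.
Qed.

(** Division by a power of a variable outside [P] turns the cycle into a section of the stalk;
    exactness there gives a preimage, and clearing denominators returns to S. *)
Lemma strand_local_exact i e (v : 'rV[S]_(strand_dim p F)) (P : S -> Prop) : virtually_linear F I d p -> (i < p)%N ->
  mxdeg (fun=> i.+1) hd 0 0 v -> mx_homog (fun=> e) tw v -> v *m D = 0 ->
  proj_point P -> exists2 b, ~ P b & exists w, b *: v = w *m D.
Proof.
move=> vlin lt_i dv hv vD PP; have le_i := ltnW lt_i.
pose y := v *m (J i)^T.
have vE : v = y *m J i by rewrite /y strand_embK_deg.
have yPi : y *m Pi i = y by rewrite /y -mulmxA strand_proj_tr_emb.
have hy : mx_homog (fun=> e) (twist i) y.
  apply: mx_homogM hv _; apply: mx_homog_tr (strand_emb_homog le_i).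
  by move=> *; apply: strand_emb_const.
clearbody y.
have kery : strand_kernel (map_mx (@tofrac S) y).
  have : y *m J i *m D = 0 by rewrite -vE.
  case: (i) (y) (yPi) (le_i) => [|j] z zPi le_j /= zD.
    by rewrite -map_mxM strand_kernel_aug ?map_mx0.
  by rewrite -map_mxM strand_kernel_diff ?map_mx0.
have [_ _ _ _ [l Pl]] := PP.
(* The exponent is [e] when d + i <= e, and otherwise y = 0; in this shape the degree shift demanded
   by [stalk] holds in both cases. *)
pose x : S := 'X_l ^+ (e - (d + i) + (d + i)).
have Px : ~ P x by apply: proj_point_Xn.
have x0 : tofrac x != 0 by rewrite tofrac_eq0; apply: proj_point_nz PP Px.
pose u := (tofrac x)^-1 *: map_mx (@tofrac S) y.
have su : strand_stalk d P u.
  move=> k; rewrite !mxE; have [tk|tk] := eqVneq (gfc_twist k) (d + i)%N.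
    exists (e - (d + i))%N, (y 0 k), x; split=> //; last by rewrite mulrC.
      by apply/dhomogP => m /hy; rewrite tk => <-; rewrite addnK.
    exact: dhomog_Xn.
  have -> : y 0 k = 0.
    by rewrite -yPi mul_mx_diag !mxE /strand_elt (negbTE tk) mulr0.
  by rewrite tofrac0 mulr0.
have keru : strand_kernel u.
  rewrite /u; case: (i) (y) kery => [|j] z /= kz; by rewrite -scalemxAl kz scaler0.
have [w sw uE] := ((vlin P PP).2 i lt_i u su).1 keru.
have [b [c [Pb cPi cE]]] := clear_denominators PP sw.
exists b => //; exists ((x *: c) *m J i.+1).
rewrite -mulmxA strand_emb_diff // !mulmxA -[x *: c *m _]scalemxAl cPi vE scalemxAl.
congr (_ *m _); apply/rowP => k; apply/eqP; rewrite -tofrac_eq; apply/eqP.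
have /rowP/(_ k) : tofrac b *: map_mx (@tofrac S) y =
    tofrac x *: (map_mx (@tofrac S) c *m frac_diff F i).
  rewrite -cE -scalemxAl -uE scalerA mulrC -scalerA [tofrac x *: u]scalerA.
  by rewrite mulfV // scale1r.
rewrite /frac_diff -map_mxM mxE [map_mx _ y _ _]mxE [RHS]mxE.
rewrite [map_mx _ (c *m _) _ _]mxE -!rmorphM -scalemxAl => e1.
by rewrite mxE [in RHS]mxE.
Qed.

(** In degree 0 the homology is S / I, and a variable outside [P] has a power in [I]. *)
Lemma strand_local_exact0 (v : 'rV[S]_(strand_dim p F)) (P : S -> Prop) : m_primary I ->
  mxdeg (fun=> 0%N) hd 0 0 v -> proj_point P -> exists2 b, ~ P b & exists w, b *: v = w *m D.
Proof.
move=> primI dv PP; have [_ _ _ _ [l Pl]] := PP.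
have [k Ix] := m_primary_Xn l primI.
exists ('X_l ^+ k); first exact: proj_point_Xn.
have [y yE] := strand_lift_ideal Ix.
rewrite {1}(strand_unitK_deg dv) scalerA mulrC -scalerA.
exists (v 0 (strand_idx p F 0 0) *: (y *m J 0)).
rewrite -scalemxAl -mulmxA strand_emb_aug !mulmxA yE.
by rewrite mul_scalar_mx.
Qed.

End StrandOfResolution.

Lemma strand_powers (K : numFieldType) (n d p t : nat)
    (F : graded_free_complex K n) (I : {mpoly K[n.+1]} -> Prop) :
  (0 < d)%N -> (n <= t * p)%N -> ideal_closed I ->
  (forall f, I f -> ideal_gen (fun v => I v /\ v \is d.-homog) f) ->
  m_primary I -> is_minimal_free_resolution F I -> virtually_linear F I d p ->
  forall g, ideal_pow I t g <-> ideal_pow (@irrelevant_ideal K n) (t * d) g.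
Proof.
move=> d_gt0 le_n II genV primI [Fres Fmin] vlin g.
have dD := @strand_diff_deg K n d p F.
have D2 := strand_diff_sq p genV Fres Fmin.
have hD := @strand_diff_homog K n d p F.
apply: ideal_pow_eq => // k v h lt_k Vv hh.
have [y hy yE] := strand_lift genV Fres Fmin Vv.
have cst m m' (A : 'M[{mpoly K[n.+1]}]_(m, m')) : mxdeg (fun=> 1%N) (fun=> 1%N) 0 0 A.
  by [].
apply: (@power_step K n d p _ (@strand_hd K n d p F) (@strand_tw K n d p F)
  (strand_diff d p F) (strand_unit p F) (strand_unit p F)^T I dD D2 hD _ _ _ _ _ _ _ _
  t k (y *m strand_emb d p F 0) v h) => //.
(* Degree 0 is settled by primarity of [I], degree i + 1 <= p by exactness at L_i. *)
- move=> l; apply: contractible_of_torsion => // -[|i] w lt_i dw wD.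
    apply: (torsion_of_local dD hD) => // e w' P dw' _ _ PP.
    exact: (strand_local_exact0 genV Fres Fmin primI dw' PP).
  apply: (torsion_of_local dD hD) => // e w' P dw' hw' w'D PP.
  exact: (strand_local_exact genV Fres Fmin vlin lt_i dw' hw' w'D PP).
(* The generator of S has degree and twist 0, so [0 < d] enters here. *)
- by move=> i; rewrite /strand_tw; case: strand_hd => [|j]; lia.
- exact: strand_unit_deg.
- exact: strand_unit_homog.
- exact/mxdeg_tr/strand_unit_deg.
- exact: strand_unit_diff.
- exact: strand_unitK.
- rewrite strand_diff_unit; apply: ideal_closed_mulmx => // i j.
  by rewrite [j]ord1; apply: (aug_ideal Fres).
- exact: (mxdegM (cst _ _ _) (strand_emb_deg (leq0n p))).
- exact: mx_homogM hy (strand_emb_homog (leq0n p)).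
by rewrite -mulmxA strand_emb_aug !mulmxA yE mul_scalar_mx.
Qed.

Theorem theorem1p2 (R : realType) (n d p m : nat)
    (f : 'I_m.+1 -> {mpoly R[i][n.+1]})
    (I : {mpoly R[i][n.+1]} -> Prop)
    (F : graded_free_complex R[i] n)
    (p_ge1 : (1 <= p)%N)
    (f_homog : forall j, f j \is d.-homog)
    (I_gen : forall g, I g <-> ideal_gen (fun h => exists j, h = f j) g)
    (I_primary : m_primary I)
    (F_res : is_minimal_free_resolution F I)
    (F_vlin : virtually_linear F I d p) :
  forall t : nat, Num.ceil (n%:R / p%:R : rat) <= t%:Z ->
    forall g : {mpoly R[i][n.+1]},
      ideal_pow I t g <-> ideal_pow (@irrelevant_ideal R[i] n) (t * d) g.
Proof.
move=> t le_t.
have le_n : (n <= t * p)%N.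
  move: le_t; rewrite ceil_le_int ler_pdivrMr ?ltr0n //.
  by rewrite -natrM ler_nat.
have II : ideal_closed I.
  have [G0 GD GM] := ideal_gen_closed (fun h => exists j, h = f j).
  split; first exact/I_gen.
    by move=> x y /I_gen Gx /I_gen Gy; apply/I_gen/GD.
  by move=> c x /I_gen Gx; apply/I_gen/GM.
have If j : I (f j) by apply/I_gen/ideal_gen_mem; exists j.
(* For d = 0 the twist bound fails at the generator of S, but then [I] is the whole ring. *)
have [d0|d_gt0] := posnP d; last first.
  apply: strand_powers I_primary F_res F_vlin => // h /I_gen.
  apply: ideal_gen_min; first exact: ideal_gen_closed.
  by move=> _ [j ->]; apply: ideal_gen_mem.
(* A nonzero form of degree 0 is a unit; if all [f j] vanished, [I] would be zero and contain no
   power of a variable. *)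
have I1 : I 1.
  have [/existsP[j nz]|/existsPn f0] := boolP [exists j, f j != 0].
    have fC : f j = ((f j)@_0)%:MP.
      apply/mpolyP => mo; rewrite mcoeffC; have [->|ne] := eqVneq mo 0%MM.
        by rewrite mulr1.
      have := f_homog j; rewrite d0 mulr0 => /dhomog_nemf_coeff; apply.
      by rewrite mdeg_eq0.
    have [_ _ IM] := II; have := IM ((f j)@_0)^-1%:MP _ (If j).
    rewrite {2}fC -mpolyCM mulVf //; apply: contraNneq nz => c0.
    by rewrite fC c0.
  have [t0 /I_gen] := m_primary_Xn ord0 I_primary.
  move=> [k [c [a [aE e]]]]; case/eqP: (oner_neq0 R[i]).
  have := congr1 (mcoeff (U_(ord0) *+ t0)) e.
  rewrite mpolyXn mcoeffX eqxx big1 ?mcoeff0 // => i _.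
  by have [j ->] := aE i; have /negPn/eqP -> := f0 j; rewrite mulr0.
move=> g; rewrite d0 muln0; split=> // _; elim: t {le_t le_n} => [|t IH] //.
by rewrite -[g]mul1r; apply: ideal_powS.
Qed.
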